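(* Let $(M,\mathcal I)$ be a hypercomplex manifold, with $\mathcal I$ generated by $I_1,I_2,I_3$, and let $F_2,F_3$ be real 2-forms on $M$ such that $F_2-iF_3$ is a $(0,2)$-form with respect to $I_1$. Suppose that $\overline\partial_1(F_2-iF_3)=0$, or equivalently $\partial_1(F_2+iF_3)=0$, and that $$g(X,Y):=-F_2(I_2X,Y)$$ is a positive definite symmetric bilinear form. Then $(M,\mathcal I,g)$ is an HKT-structure.
   Context: A hypercomplex structure $\mathcal I$ on a smooth manifold $M$ is given by three integrable complex structures $I_1,I_2,I_3$ with $I_1^2=I_2^2=I_3^2=-1$ and $I_1I_2=I_3=-I_2I_1$. A hyper-Hermitian manifold $(M,\mathcal I,g)$ is a hypercomplex manifold with a Riemannian metric $g$ such that $g(X,Y)=g(I_aX,I_aY)$ for $a=1,2,3$. A linear connection $\nabla$ on a hyper-Hermitian manifold is hyper-Kähler (an HKT-connection) if $\nabla g=0$, $\nabla I_1=\nabla I_2=\nabla I_3=0$, and its torsion $T$ is totally skew-symmetric, i.e. $c(X,Y,Z)=g(X,T(Y,Z))$ is a 3-form. $(M,\mathcal I,g)$ is an HKT-structure if it is hyper-Hermitian and admits an HKT-connection. $\partial_1$ and $\overline\partial_1$ denote the usual $\partial$- and $\overline\partial$-operators of the complex structure $I_1$. *)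

(* Defs.v *)
From HB Require Import structures.
From mathcomp Require Import all_boot all_order all_algebra.
From mathcomp Require Import all_classical all_reals all_analysis.
From mathcomp Require Import ring.

Set Implicit Arguments.
Unset Strict Implicit.
Unset Printing Implicit Defensive.

Import Order.TTheory GRing.Theory Num.Theory.
Import numFieldNormedType.Exports.

Local Open Scope classical_set_scope.
Local Open Scope ring_scope.

(* Used with [U] open and [V] finite-dimensional, where it is the usual class
   C^k: x |-> Df(x) is C^k iff x |-> Df(x)(v) is C^k for every v. *)
Fixpoint Ck (R : realType) (V W : normedModType R) (k : nat) (U : set V)
    (f : V -> W) : Prop :=
  if k is k'.+1
  then (forall x, U x -> differentiable f x) /\
       (forall v : V, Ck k' U (fun x => 'D_v f x))
  else forall x, U x -> {for x, continuous f}.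

Definition smooth_on (R : realType) (V W : normedModType R) (U : set V)
  (f : V -> W) : Prop := forall k, Ck k U f.

Section CkTheory.
Variables (R : realType) (V : normedModType R).

Lemma near_eq_differentiable (W : normedModType R) (f g : V -> W) (x : V) :
  {near x, f =1 g} -> differentiable f x -> differentiable g x.
Proof.
move=> fg df.
have sfg : g \o shift x = cst (g x) + 'd f x +o_ 0 id.
  apply/eqaddoP => e e0; have /eqaddoP/(_ e e0) := diff_locally df.
  have : \forall h \near 0, f (h + x) = g (h + x).
    by move: fg; rewrite (near_shift 0 x); apply: filterS => h /=; rewrite subr0.
  apply: filterS2 => h /= E; rewrite !fctE /= -E.
  by rewrite -[g x](nbhs_singleton fg).
have dE := diff_unique (diff_continuous df) sfg.
by apply/diff_locallyP; rewrite dE; split=> //; exact: diff_continuous.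
Qed.

Variable U : set V.
Hypothesis Uo : open U.
Implicit Types f g : V -> R^o.

Let near_U f g x : (forall y, U y -> f y = g y) -> U x -> {near x, f =1 g}.
Proof.
move=> fg Ux; have : \forall y \near x, U y by exact: open_nbhs_nbhs.
by apply: filterS => y /fg.
Qed.

Lemma Ck_eq k f g : (forall x, U x -> f x = g x) -> Ck k U f -> Ck k U g.
Proof.
elim: k f g => [|k IH] f g fg /=.
  move=> fc x Ux; have := fc x Ux; rewrite /prop_for /continuous_at -(fg x Ux).
  apply: cvg_trans; apply: near_eq_cvg.
  by have := near_U fg Ux; apply: filterS => y ->.
case=> df Df; split=> [x Ux|v].
  exact: near_eq_differentiable (near_U fg Ux) (df x Ux).
by apply: IH (Df v) => x Ux; apply: near_eq_derive; exact: near_U.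
Qed.

Lemma Ck_le k f : Ck k.+1 U f -> Ck k U f.
Proof.
elim: k f => [|k IH] f [df Df] /=.
  by move=> x Ux; apply: differentiable_continuous; exact: df.
by split=> // v; exact: IH (Df v).
Qed.

Lemma Ck_cst k (a : R) : Ck k U (cst a : V -> R^o).
Proof.
elim: k a => [|k IH] a /=; first by move=> x _; exact: cst_continuous.
split=> [x _|v]; first exact: differentiable_cst.
by apply: Ck_eq (IH 0) => x _ /=; rewrite derive_cst.
Qed.

Lemma Ck_add k f g : Ck k U f -> Ck k U g -> Ck k U (f + g).
Proof.
elim: k f g => [|k IH] f g /=.
  by move=> fc gc x Ux; apply: continuousD; [exact: fc|exact: gc].
move=> [df Df] [dg Dg]; split=> [x Ux|v].
  by apply: differentiableD; [exact: df|exact: dg].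
apply: Ck_eq (IH _ _ (Df v) (Dg v)) => x Ux /=.
by rewrite deriveD //; apply: diff_derivable; [exact: df|exact: dg].
Qed.

Lemma Ck_mul k f g : Ck k U f -> Ck k U g -> Ck k U (f * g).
Proof.
elim: k f g => [|k IH] f g.
  by move=> fc gc x Ux; apply: continuousM; [exact: fc|exact: gc].
move=> Cf Cg; have [[df Df] [dg Dg]] := (Cf, Cg); split=> [x Ux|v].
  by apply: differentiableM; [exact: df|exact: dg].
have := Ck_add (IH _ _ (Ck_le Cf) (Dg v)) (IH _ _ (Ck_le Cg) (Df v)).
apply: Ck_eq => x Ux /=.
by rewrite deriveM //; apply: diff_derivable; [exact: df|exact: dg].
Qed.

End CkTheory.

Record chart (R : realType) (n : nat) (M : topologicalType) := Chart {
  chart_dom : set M ;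
  chart_map : M -> 'rV[R]_n ;
  chart_inv : 'rV[R]_n -> M ;
  chart_dom_open : open chart_dom ;
  chart_img_open : open (chart_map @` chart_dom) ;
  chart_mapK : {in chart_dom, cancel chart_map chart_inv} ;
  chart_map_continuous : {in chart_dom, continuous chart_map} ;
  chart_inv_continuous : {in chart_map @` chart_dom, continuous chart_inv}
}.

(* The atlas need not be maximal. *)
Record manifold (R : realType) (n : nat) := Manifold {
  carrier :> topologicalType ;
  hausdorff_carrier : hausdorff_space carrier ;
  second_countable_carrier : @second_countable carrier ;
  atlas : set (chart R n carrier) ;
  atlas_cover : forall p : carrier, exists2 c, atlas c & chart_dom c p ;
  atlas_compatible : forall c d, atlas c -> atlas d ->
    smooth_on (chart_map c @` (chart_dom c `&` chart_dom d))
      (chart_map d \o chart_inv c)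
}.

Section SmoothFunctions.
Variables (R : realType) (n : nat) (M : manifold R n).

Definition smooth (f : M -> R) : Prop := forall c, atlas c ->
  smooth_on (chart_map c @` chart_dom c) (f \o chart_inv c : 'rV[R]_n -> R^o).

Definition smooth_pred : {pred M -> R} := fun f => `[< smooth f >].

Fact smooth_subring_closed : subring_closed smooth_pred.
Proof.
have cstP (a : R) : smooth (cst a).
  by move=> c _ k; apply: Ck_cst; exact: chart_img_open.
have addP f g : smooth f -> smooth g -> smooth (f + g).
  move=> fs gs c cA k.
  exact: (Ck_add (@chart_img_open _ _ _ c) (fs c cA k) (gs c cA k)).
have mulP f g : smooth f -> smooth g -> smooth (f * g).
  move=> fs gs c cA k.
  exact: (Ck_mul (@chart_img_open _ _ _ c) (fs c cA k) (gs c cA k)).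
split; first by apply/asboolP; exact: (cstP 1).
  move=> f g /asboolP fs /asboolP gs; apply/asboolP.
  rewrite -mulN1r; apply: addP => //; apply: mulP => //; exact: (cstP (- 1)).
by move=> f g /asboolP fs /asboolP gs; apply/asboolP; exact: mulP.
Qed.
HB.instance Definition _ :=
  GRing.isSubringClosed.Build _ smooth_pred smooth_subring_closed.

Fact smooth_scaler_closed : GRing.scaler_closed smooth_pred.
Proof.
move=> a f fs; have -> : a *: f = cst a * f by [].
apply: rpredM => //; apply/asboolP => c _ k.
by apply: Ck_cst; exact: chart_img_open.
Qed.
HB.instance Definition _ :=
  GRing.isScaleClosed.Build _ _ smooth_pred smooth_scaler_closed.

Record smoothfun := SmoothFun {
  smoothfun_fun :> M -> R ;
  _ : smoothfun_fun \in smooth_pred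
}.
HB.instance Definition _ := [isSub for smoothfun_fun].
HB.instance Definition _ := [Choice of smoothfun by <:].
HB.instance Definition _ := GRing.SubChoice_isSubComPzRing.Build
  _ _ smoothfun smooth_subring_closed.
HB.instance Definition _ := [SubZmodule_isSubLmodule of smoothfun by <:].

End SmoothFunctions.

Section VectorFields.
Variables (R : realType) (n : nat) (M : manifold R n).
Local Notation C := (smoothfun M).

Definition leibniz (X : C -> C) : Prop :=
  forall f g, X (f * g) = X f * g + f * X g.

(* Vector fields are the derivations of the R-algebra C^oo(M).
   [C^o] is C^oo(M) as a module over itself, so that the derivations form a
   submodule of the C^oo(M)-module [C -> C^o]; [linear X] in the body is
   linearity over [R]. *)
Definition derivation : {pred C -> C^o} :=
  fun X => `[< linear (X : C -> C) /\ leibniz X >].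

Fact derivation_submod_closed : submod_closed derivation.
Proof.
have E0 (f : C) : (0 : C -> C^o) f = 0 by [].
split; first by apply/asboolP; split=> [a f g|f g];
  rewrite !E0 ?scaler0 ?mul0r ?mulr0 addr0.
move=> h X Y /asboolP[Xl XL] /asboolP[Yl YL]; apply/asboolP.
have E (f : C) : (h *: X + Y) f = h * X f + Y f by [].
split=> [a f g|f g]; rewrite !E.
  rewrite Xl Yl mulrDr scalerDr !addrA; congr (_ + _).
  rewrite -!addrA [h * X g + _]addrC !addrA; congr (_ + _ + _).
  by apply/val_inj/funext => x /=; rewrite /GRing.scale/= mulrCA.
rewrite XL YL !mulrDr !mulrDl !mulrA [f * h]mulrC.
by rewrite -!addrA; congr (_ + _); rewrite addrCA.
Qed.
HB.instance Definition _ := GRing.isSubmodClosed.Build _ _ derivation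
  derivation_submod_closed.

Record vfield := VField {
  vfield_fun :> C -> C^o ;
  _ : vfield_fun \in derivation
}.
HB.instance Definition _ := [isSub for vfield_fun].
HB.instance Definition _ := [Choice of vfield by <:].
HB.instance Definition _ := [SubChoice_isSubZmodule of vfield by <:].
HB.instance Definition _ := [SubZmodule_isSubLmodule of vfield by <:].

Fact bracket_subproof (X Y : vfield) :
  (fun f : C => X (Y f) - Y (X f)) \in derivation.
Proof.
case: X Y => [X /asboolP[Xl XL]] [Y /asboolP[Yl YL]] /=.
have XD f g : X (f + g) = X f + X g by have := Xl 1 f g; rewrite !scale1r.
have YD f g : Y (f + g) = Y f + Y g by have := Yl 1 f g; rewrite !scale1r.
apply/asboolP; split=> [a f g|f g].
  by rewrite Yl !Xl Yl scalerBr opprD addrACA.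
rewrite XL YL XD YD !XL !YL; ring.
Qed.

Definition bracket (X Y : vfield) : vfield := VField (bracket_subproof X Y).

(* The tangent vector X_p is the point derivation f |-> (X f)(p). *)
Definition nonzero_at (X : vfield) (p : M) : Prop :=
  exists f : C, (X f : C) p != 0.

End VectorFields.

(* Tensor fields are represented by C^oo(M)-multilinear maps on vector fields;
   for vector-valued (1,1)-tensors this is {linear vfield M -> vfield M}. *)
Section Tensors.
Variables (R : realType) (n : nat) (M : manifold R n).
Local Notation C := (smoothfun M).
Local Notation V := (vfield M).

Definition tensor2 (g : V -> V -> C) : Prop :=
  (forall X, scalar (g X)) /\ (forall Y, scalar (g^~ Y)).

Definition form2 (F : V -> V -> C) : Prop :=
  tensor2 F /\ forall X, F X X = 0.

Definition form3 (c : V -> V -> V -> C) : Prop :=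
  [/\ forall X, form2 (c X),
      forall Y Z, scalar (fun X => c X Y Z) &
      forall X Y, c X X Y = 0].

Definition riemannian_metric (g : V -> V -> C) : Prop :=
  [/\ tensor2 g,
      forall X Y, g X Y = g Y X &
      forall X p, nonzero_at X p -> 0 < g X X p].

(* Exterior derivative, without the factor 1/3 of some authors. *)
Definition dform2 (F : V -> V -> C) (X Y Z : V) : C :=
  (X (F Y Z) : C) + Y (F Z X) + Z (F X Y)
  - F (bracket X Y) Z - F (bracket Y Z) X - F (bracket Z X) Y.

Definition linear_connection (nabla : V -> V -> V) : Prop :=
  [/\ forall Y, linear (nabla^~ Y),
      forall X Y Z, nabla X (Y + Z) = nabla X Y + nabla X Z &
      forall X (f : C) Y,
        nabla X (f *: Y) = (X f : C) *: Y + f *: nabla X Y].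

Definition torsion (nabla : V -> V -> V) (X Y : V) : V :=
  nabla X Y - nabla Y X - bracket X Y.

Definition nijenhuis (I : V -> V) (X Y : V) : V :=
  bracket (I X) (I Y) - I (bracket (I X) Y) - I (bracket X (I Y))
  - bracket X Y.

(* Integrability of an almost complex structure is the vanishing of its
   torsion, as in Kobayashi-Nomizu. *)
Definition integrable_complex_structure (I : {linear V -> V}) : Prop :=
  (forall X, I (I X) = - X) /\ (forall X Y, nijenhuis I X Y = 0).

End Tensors.

(* The complexification W + iW of a real vector space W is represented by
   [W * W], the pair [(a, b)] standing for a + ib. *)
Section Complexification.

Definition cI (W : zmodType) (w : W * W) : W * W := (- w.2, w.1).

(* Complex-linear extension to V + iV of an additive f : V -> W + iW. *)
Definition cext (V W : zmodType) (f : V -> W * W) (z : V * V) : W * W :=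
  f z.1 + cI (f z.2).

Definition cext2 (V W : zmodType) (w : V -> V -> W * W) (z1 z2 : V * V) :=
  cext (fun X => cext (w X) z2) z1.

Definition cext3 (V W : zmodType) (w : V -> V -> V -> W * W)
    (z1 z2 z3 : V * V) :=
  cext (fun X => cext2 (w X) z2 z3) z1.

End Complexification.

Section Dolbeault.
Variables (R : realType) (n : nat) (M : manifold R n).
Local Notation C := (smoothfun M).
Local Notation V := (vfield M).
Variable I : {linear V -> V}.
Implicit Types w : V -> V -> C * C.

(* The component of a real vector field in T^{1,0} (for [b = true]), namely
   (X - i I X) / 2, or in T^{0,1} (for [b = false]), namely (X + i I X) / 2. *)
Definition type_proj (b : bool) (X : V) : V * V :=
  let half : C := (2^-1 : R) *: (1 : C) in
  (half *: X, if b then - (half *: I X) else half *: I X).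

(* [type_part2 p w] and [type_part3 p w] are the components of bidegrees
   (p, 2 - p) and (p, 3 - p). *)
Definition type_part2 (p : nat) w (X Y : V) : C * C :=
  \sum_(b : bool * bool | (b.1 + b.2 == p)%N)
    cext2 w (type_proj b.1 X) (type_proj b.2 Y).

Definition type_part3 (p : nat) (w : V -> V -> V -> C * C) (X Y Z : V)
    : C * C :=
  \sum_(b : bool * bool * bool | (b.1.1 + b.1.2 + b.2 == p)%N)
    cext3 w (type_proj b.1.1 X) (type_proj b.1.2 Y) (type_proj b.2 Z).

Definition has_type2 (p : nat) w : Prop :=
  forall X Y, type_part2 p w X Y = w X Y.

Definition cdform2 w (X Y Z : V) : C * C :=
  (dform2 (fun A B => (w A B).1) X Y Z, dform2 (fun A B => (w A B).2) X Y Z).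

(* On a form of bidegree (p, 2 - p), [del] and [delbar] are the components of
   bidegrees (p + 1, 2 - p) and (p, 3 - p) of its exterior derivative. *)
Definition del w (X Y Z : V) : C * C :=
  \sum_(p < 3) type_part3 p.+1 (cdform2 (type_part2 p w)) X Y Z.

Definition delbar w (X Y Z : V) : C * C :=
  \sum_(p < 3) type_part3 p (cdform2 (type_part2 p w)) X Y Z.

End Dolbeault.

Section HKT.
Variables (R : realType) (n : nat) (M : manifold R n).
Local Notation C := (smoothfun M).
Local Notation V := (vfield M).
(* Linearity is over C^oo(M). *)
Variables I1 I2 I3 : {linear V -> V}.

Definition hypercomplex : Prop :=
  [/\ integrable_complex_structure I1,
      integrable_complex_structure I2,
      integrable_complex_structure I3,
      forall X, I1 (I2 X) = I3 X &
      forall X, I2 (I1 X) = - I3 X].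

Definition hyperhermitian (g : V -> V -> C) : Prop :=
  [/\ hypercomplex, riemannian_metric g &
      forall X Y, [/\ g X Y = g (I1 X) (I1 Y),
                      g X Y = g (I2 X) (I2 Y) &
                      g X Y = g (I3 X) (I3 Y)]].

Definition hkt_connection (g : V -> V -> C) (nabla : V -> V -> V) : Prop :=
  [/\ linear_connection nabla,
      forall X Y Z : V, (X (g Y Z) : C) = g (nabla X Y) Z + g Y (nabla X Z),
      forall X Y, [/\ nabla X (I1 Y) = I1 (nabla X Y),
                      nabla X (I2 Y) = I2 (nabla X Y) &
                      nabla X (I3 Y) = I3 (nabla X Y)] &
      form3 (fun X Y Z => g X (torsion nabla Y Z))].

Definition hkt_structure (g : V -> V -> C) : Prop :=
  hyperhermitian g /\ exists nabla : V -> V -> V, hkt_connection g nabla.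

End HKT.

(* Main.v *)
Require Import Defs.
From HB Require Import structures.
From mathcomp Require Import all_boot all_order all_algebra.
From mathcomp Require Import all_classical all_reals all_analysis.
From mathcomp Require Import ring lra.

Set Implicit Arguments.
Unset Strict Implicit.
Unset Printing Implicit Defensive.

Import Order.TTheory GRing.Theory Num.Theory.
Import numFieldNormedType.Exports.

Local Open Scope classical_set_scope.
Local Open Scope ring_scope.

(* Let g := - F2 (I2 ., .), so that F_a = g (I_a ., .). The (0,2)-type condition
   makes g hyper-Hermitian. Integrability of I1 kills the (2,1)- and
   (3,0)-components of d(F2 - i F3) and the hypothesis kills the (0,3)-component;
   being of type (1,2) for I1, it satisfies dF3 (I1 ., I1 ., I1 .) = dF2, hence
     dF2 (I2 ., I2 ., I2 .) = dF3 (I3 ., I3 ., I3 .) =: c.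
   By Bismut's theorem the metric connection with torsion c, given by Koszul's
   formula, preserves both I2 and I3, hence also I1 = I2 I3.

   Vector fields being derivations of C^oo(M), solving Koszul's formula for the
   connection requires that every C^oo(M)-linear map from vector fields to
   functions be of the form g (Z, .). Hadamard's lemma and bump functions show
   that derivations are locally combinations of coordinate fields; inverting the
   Gram matrix gives Z locally, and the local solutions agree because g is
   definite. *)

(** * Hadamard's lemma *)

(** A vector field acts only on globally defined smooth functions, so every local construction has
    to be multiplied by a bump function before a field can act on it. Hadamard's lemma is needed
    with smooth coefficients, because the Leibniz rule is applied to the products in its remainder;
    a mean value estimate would not do. On the algebraic side, the type condition reads omega(I1 X,
    Y) = -i omega(X, Y) for omega = F2 - i F3. The equality of the two expressions for c is the
    relation dF3(I1 ., I1 ., I1 .) = dF2 evaluated at I2 X, I2 Y, I2 Z, since I3 = I1 I2. It is the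
    heart of the matter: each integrable Hermitian structure determines the torsion of its
    skew-torsion connection, and one connection can serve I2 and I3 only if the two torsions agree.
    The two forms of the Dolbeault hypothesis are complex conjugates of each other. *)

Section RowDifferential.
Variables (R : realType) (n : nat).
Implicit Types (x v h : 'rV[R]_n) (c : 'I_n -> R).

Definition dotc c v : R^o := \sum_i v 0 i * c i.

Fact dotc_linear c : linear (dotc c).
Proof.
move=> a u v; rewrite /dotc scaler_sumr -big_split /=; apply: eq_bigr => i _.
by rewrite !mxE mulrDl -mulrA.
Qed.
HB.instance Definition _ c :=
  GRing.isLinear.Build R 'rV[R]_n R^o _ (dotc c) (dotc_linear c).

Lemma le_row_norm v i : `|v 0 i| <= `|v|.
Proof.
have -> : `|v| = mx_norm v by [].
by rewrite mx_normrE (le_trans _ (le_bigmax _ _ (0, i))).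
Qed.

Lemma le_dotc c v : `|dotc c v| <= `|v| * \sum_i `|c i|.
Proof.
rewrite (le_trans (ler_norm_sum _ _ _))// mulr_sumr ler_sum// => i _.
by rewrite normrM ler_wpM2r// le_row_norm.
Qed.

Lemma dotc_continuous c : continuous (dotc c).
Proof.
apply: bounded_linear_continuous; apply/linear_boundedP => //.
exists (\sum_i `|c i|); split; first exact: num_real.
move=> M cM v; rewrite (le_trans (le_dotc _ _))// mulrC ler_wpM2r//.
exact: ltW.
Qed.

(** By uniqueness of the differential, a linear approximation up to o(h) yields differentiability
    and all directional derivatives at once. *)
Lemma row_differentiable (f : 'rV[R]_n -> R^o) c x :
  (forall e : R, 0 < e -> \forall h \near (0 : 'rV[R]_n),
     `|f (h + x) - f x - dotc c h| <= e * `|h|) ->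
  differentiable f x /\ forall v, 'D_v f x = dotc c v.
Proof.
move=> fe.
have E : f \o shift x = cst (f x) + dotc c +o_ (0 : 'rV[R]_n) id.
  apply/eqaddoP => e /fe; apply: filterS => h.
  by rewrite !fctE /= opprD addrA.
have dE := diff_unique (dotc_continuous (c := c)) E.
have df : differentiable f x.
  by apply/diff_locallyP; rewrite dE; split=> //; exact: dotc_continuous.
by split=> // v; rewrite deriveE// dE.
Qed.

Lemma derive_sum_partial (f : 'rV[R]_n -> R^o) x v : differentiable f x ->
  'D_v f x = dotc (fun i => 'D_(delta_mx 0 i) f x) v.
Proof.
move=> df; rewrite deriveE// {1}[v]row_sum_delta linear_sum /dotc.
by apply: eq_bigr => i _; rewrite linearZ/= deriveE.
Qed.

End RowDifferential.

Section SmoothOn.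
Variables (R : realType) (V W : normedModType R).
Implicit Types (U : set V) (f g : V -> W).

Lemma smooth_on_differentiable U f x :
  smooth_on U f -> U x -> differentiable f x.
Proof. by move=> /(_ 1%N)[df _] /df. Qed.

Lemma smooth_on_continuous U f x :
  smooth_on U f -> U x -> {for x, continuous f}.
Proof. by move=> /(_ 0%N); exact. Qed.

Lemma smooth_on_derive U f v : smooth_on U f -> smooth_on U ('D_v f).
Proof. by move=> fs k; have [_] := fs k.+1; exact. Qed.

Lemma Ck_subset k U U' f : U' `<=` U -> Ck k U f -> Ck k U' f.
Proof.
move=> U'U; elim: k f => [|k IH] f /=; first by move=> fc x /U'U/fc.
by move=> [df Df]; split=> [x /U'U/df//|v]; exact: IH.
Qed.

(** Derivatives are those of the total function [f] in the whole space, and the set only says where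
    they are tested; hence [U'] may be arbitrary. *)
Lemma Ck_local k U f :
  (forall x, U x -> exists2 U', U' x & Ck k U' f) -> Ck k U f.
Proof.
elim: k f => [|k IH] f loc /=; first by move=> x /loc[U' U'x]; exact.
split=> [x /loc[U' U'x [df _]]|v]; first exact: df.
by apply: IH => x /loc[U' U'x [_ Df]]; exists U'; last exact: Df.
Qed.

End SmoothOn.

Lemma smooth_on_eq (R : realType) (V : normedModType R) (U : set V)
    (f g : V -> R^o) :
  open U -> (forall x, U x -> f x = g x) -> smooth_on U f -> smooth_on U g.
Proof. by move=> Uo fg fs k; exact: (Ck_eq Uo fg (fs k)). Qed.

(** * Averages along segments and differentiation under the integral sign *)

Section SegmentAverage.
Variables (R : realType) (n : nat).
Local Notation V := 'rV[R]_n.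
Local Notation mu := (@lebesgue_measure R).
Local Notation I01 := `[0%R, 1%R]%classic.

Definition seg (a x : V) (s : R) : V := a + s *: (x - a).

Variables (U : set V) (a : V).
Hypothesis Uo : open U.
Hypothesis Ustar : forall x (s : R), U x -> 0 <= s <= 1 -> U (seg a x s).

Lemma seg_continuous x : continuous (seg a x).
Proof.
move=> s; apply: cvgD; first exact: cvg_cst.
by apply: cvgZr_tmp; exact: cvg_id.
Qed.

(** A tube lemma: by compactness of [0,1], one neighbourhood of 0 serves all points of the
    segment. *)
Lemma seg_uniform_continuity (G : V -> R^o) x (e : R) :
  (forall y, U y -> {for y, continuous G}) ->
  U x -> 0 < e -> \forall k \near (0 : V), forall s : R, 0 <= s <= 1 ->
    U (seg a x s + k) /\ `|G (seg a x s + k) - G (seg a x s)| <= e.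
Proof.
move=> Gc Ux e0.
have /compact_near_coveringP/near_covering_withinP := @segment_compact R 0 1.
move=> /(_ V (nbhs (0 : V)) (fun k s => U (seg a x s + k) /\
   `|G (seg a x s + k) - G (seg a x s)| <= e)) cov.
suff /(cov _) : forall s0 : R, I01 s0 -> \forall s \near s0 & k \near (0 : V),
    I01 s -> U (seg a x s + k) /\ `|G (seg a x s + k) - G (seg a x s)| <= e.
  by apply: filterS => k + s s01; apply; rewrite /= in_itv.
move=> s0; rewrite /= in_itv /= => s01.
have Us0 := Ustar Ux s01.
have L : seg a x z.1 + z.2 @[z --> (s0, 0 : V)] --> seg a x s0.
  rewrite -[X in _ --> X]addr0; apply: cvgD; last exact: cvg_snd.
  by apply: cvg_comp; [exact: cvg_fst|exact: seg_continuous].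
have L1 : seg a x z.1 @[z --> (s0, 0 : V)] --> seg a x s0.
  by apply: cvg_comp; [exact: cvg_fst|exact: seg_continuous].
have GL := cvg_comp _ _ L (Gc _ Us0); have GL1 := cvg_comp _ _ L1 (Gc _ Us0).
have e20 : 0 < e / 2 by rewrite divr_gt0.
have UL := L _ (open_nbhs_nbhs (conj Uo Us0)).
have /= N1 := (cvgrPdist_le _ _).1 GL _ e20.
have /= N2 := (cvgrPdist_le _ _).1 GL1 _ e20.
near=> z => _; split; first by near: z; exact: UL.
rewrite distrC (splitr e) -(subrKA (G (seg a x s0))).
rewrite (le_trans (ler_normD _ _))// lerD//; last by near: z; exact: N1.
by rewrite distrC; near: z; exact: N2.
Unshelve. all: by end_near. Qed.

(* Averages along segments: differentiating under the integral sign sends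
   [seg_avg k G] to [seg_avg k.+1 ('D_v G)], so this class of functions is
   stable under differentiation. *)
Definition seg_avg (k : nat) (G : V -> R^o) (x : V) : R^o :=
  \int[mu]_(s in I01) (s ^+ k * G (seg a x s)).

Lemma seg_integrable k (G : V -> R^o) x :
  (forall y, U y -> {for y, continuous G}) -> U x ->
  mu.-integrable I01 (EFin \o (fun s => s ^+ k * G (seg a x s))).
Proof.
move=> Gc Ux; apply: continuous_compact_integrable; first exact: segment_compact.
apply: continuous_in_subspaceT => s /set_mem; rewrite /= in_itv/= => s01.
apply: cvgM; first exact: exprn_continuous.
apply: continuous_comp; first exact: seg_continuous.
by apply: Gc; exact: Ustar.
Qed.

Lemma le_norm_integral01 (f : R -> R) (e : R) :
  mu.-integrable I01 (EFin \o f) -> (forall s : R, 0 <= s <= 1 -> `|f s| <= e) ->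
  `|\int[mu]_(s in I01) f s| <= e.
Proof.
move=> fi fe; rewrite (le_trans (le_normr_Rintegral _ _))//.
have <- : \int[mu]_(s in I01) e = e.
  rewrite Rintegral_cst//; have := @lebesgue_measure_itv R `[0%R, 1%R].
  by rewrite /= lte_fin ltr01 => ->; rewrite oppr0 adde0 mulr1.
apply: le_Rintegral => //.
- exact: integrable_norm.
- apply: continuous_compact_integrable; first exact: segment_compact.
  by move=> ?; exact: cvg_cst.
Qed.

Lemma seg_shift x h s : seg a (h + x) s = seg a x s + s *: h.
Proof. by rewrite /seg -(addrA h) scalerDr addrCA addrC. Qed.

(** The integral commutes with the expansion of ['D_v] into partial derivatives. This puts the
    candidate differential of an average in the form expected by [row_differentiable]. *)
Lemma seg_avg_linear k (G : V -> R^o) x v : U x ->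
  (forall y, U y -> differentiable G y) ->
  (forall v y, U y -> {for y, continuous ('D_v G)}) ->
  seg_avg k ('D_v G) x = dotc (fun i => seg_avg k ('D_(delta_mx 0 i) G) x) v.
Proof.
move=> Ux dG DGc; rewrite /seg_avg /dotc.
transitivity (\int[mu]_(s in I01)
    \sum_i (v 0 i * (s ^+ k * 'D_(delta_mx 0 i) G (seg a x s)))).
  apply: eq_Rintegral => s /set_mem; rewrite /= in_itv => s01.
  rewrite derive_sum_partial /dotc; last by apply/dG/Ustar.
  by rewrite mulr_sumr; apply: eq_bigr => i _; rewrite mulrCA.
rewrite /Rintegral; under eq_integral do rewrite -sumEFin.
rewrite integral_sum//=; last first.
  by move=> i; exact: integrableZl (seg_integrable k (@DGc _) Ux).
rewrite -sum_fine; last first.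
  move=> i _; apply: integrable_fin_num => //.
  exact: integrableZl (seg_integrable k (@DGc _) Ux).
apply: eq_bigr => i _; rewrite -RintegralZl//.
exact: seg_integrable (@DGc _) Ux.
Qed.

Lemma segment_MVT (G : V -> R^o) y v :
  (forall t : R, 0 <= t <= 1 -> differentiable G (y + t *: v)) ->
  exists2 t : R, 0 <= t <= 1 & G (y + v) - G y = 'D_v G (y + t *: v).
Proof.
move=> dG; pose p (t : R) := y + t *: v.
have dp (t : R) : is_diff t (p : R -> V) ( *:%R^~ v).
  have -> : ( *:%R^~ v : R -> V) = 0 + *:%R^~ v by rewrite add0r.
  exact: is_diffD.
have dGp (t : R) : 0 <= t <= 1 -> is_derive t 1 (G \o p) ('D_v G (p t)).
  move=> t01; have dGt := dG _ t01.
  have d : differentiable (G \o p) t by exact: differentiable_comp.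
  apply: DeriveDef; first exact: diff_derivable.
  by rewrite !deriveE// diff_comp//= diff_val scale1r.
have [t| |t t01] := @MVT_segment R (G \o p) (fun t => 'D_v G (p t)) 0 1 ler01.
- by rewrite in_itv/= => /andP[t0 t1]; apply: dGp; rewrite !ltW.
- apply: continuous_in_subspaceT => t /set_mem; rewrite /= in_itv/= => t01.
  by apply/differentiable_continuous/derivable1_diffP; have [] := dGp _ t01.
- by rewrite /= /p scale1r scale0r addr0 subr0 mulr1; exists t.
Qed.

(** Moving x by h moves the point of parameter s by s h; this factor s is what raises the exponent
    k. The mean value theorem bounds the error in the integrand by the variation of the partial
    derivatives, which is uniformly small along the segment. *)
Lemma seg_avg_derive k (G : V -> R^o) x : U x ->
  (forall y, U y -> differentiable G y) ->
  (forall v y, U y -> {for y, continuous ('D_v G)}) ->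
  differentiable (seg_avg k G) x /\
  forall v, 'D_v (seg_avg k G) x = seg_avg k.+1 ('D_v G) x.
Proof.
move=> Ux dG DGc.
suff : differentiable (seg_avg k G) x /\ forall v, 'D_v (seg_avg k G) x =
    dotc (fun i => seg_avg k.+1 ('D_(delta_mx 0 i) G) x) v.
  by case=> d D; split=> // v; rewrite D seg_avg_linear.
apply: row_differentiable => e e0.
have Gc y : U y -> {for y, continuous G}.
  by move=> Uy; apply: differentiable_continuous; exact: dG.
(* The error e is shared among the n coordinates; [n.+1] keeps the quotient meaningful in dimension
   0. *)
have e1 : 0 < e / n.+1%:R by rewrite divr_gt0.
have : \forall k \near (0 : V), forall i (s : R), 0 <= s <= 1 ->
    U (seg a x s + k) /\ `|'D_(delta_mx 0 i) G (seg a x s + k) -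
       'D_(delta_mx 0 i) G (seg a x s)| <= e / n.+1%:R.
  have H i := seg_uniform_continuity (@DGc (delta_mx 0 i)) Ux e1.
  by near=> k0 => i; move: i; near: k0; apply: filter_forall => i; exact: H.
have := seg_uniform_continuity Gc Ux e1.
move=> /nbhs_normP[d0 /= d00 Ud'] /nbhs_normP[d /= d10 Gd'].
have Ud w : `|w| < d0 -> forall s : R, 0 <= s <= 1 -> U (seg a x s + w).
  by move=> wd s s01; have /Ud'/(_ s s01)[] : ball_ Num.norm 0 d0 w
    by rewrite /ball_/= sub0r normrN.
have Gd w : `|w| < d -> forall i (s : R), 0 <= s <= 1 ->
    `|'D_(delta_mx 0 i) G (seg a x s + w) -
      'D_(delta_mx 0 i) G (seg a x s)| <= e / n.+1%:R.
  by move=> wd i s s01; have /Gd'/(_ i s s01)[] : ball_ Num.norm 0 d w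
    by rewrite /ball_/= sub0r normrN.
have : \forall h \near (0:V), `|h| < Num.min d0 d.
  by apply: nbhs0_lt; rewrite lt_min d00.
apply: filterS => h; rewrite lt_min => /andP[hd0 hd].
have Uxh : U (h + x).
  have := Ud _ hd0 1; rewrite /seg scale1r subrKC addrC; apply.
  by rewrite ler01 lexx.
have i1 := seg_integrable k Gc Uxh.
have i2 := seg_integrable k Gc Ux.
have i3 := seg_integrable k.+1 (@DGc h) Ux.
have i4 : mu.-integrable I01 (EFin \o (fun s => s ^+ k * G (seg a (h + x) s) -
    s ^+ k * G (seg a x s))) by exact: integrableB i1 i2.
rewrite -seg_avg_linear// /seg_avg -!RintegralB//=.
apply: le_norm_integral01; first exact: integrableB i4 i3.
move=> s s01; have /andP[s0 s1] := s01.
have seg_ball (t : R) : 0 <= t <= 1 -> `|t *: (s *: h)| <= `|h|.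
  move=> /andP[t0 t1]; rewrite !normrZ mulrA ler_piMl// -normrM.
  rewrite ger0_norm ?mulr_ge0//.
  exact: mulr_ile1.
(* The intermediate t depends on s, which is harmless because the estimate of the partial
   derivatives is uniform. *)
have [t t01 E] : exists2 t : R, 0 <= t <= 1 &
    G (seg a x s + s *: h) - G (seg a x s) =
    'D_(s *: h) G (seg a x s + t *: (s *: h)).
  apply: segment_MVT => t t01; apply: dG; apply: Ud => //.
  by rewrite (le_lt_trans (seg_ball _ t01)).
rewrite seg_shift -mulrBr E exprSr -mulrA -mulrBr normrM.
set y := _ + t *: _.
have Uy : U y.
  apply: Ud => //; by rewrite (le_lt_trans (seg_ball _ t01)).
have -> : 'D_(s *: h) G y = s * 'D_h G y.
  by rewrite !deriveE ?linearZ//; exact: dG.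
rewrite -mulrBr normrM mulrA -normrM -exprSr.
rewrite (@le_trans _ _ `|'D_h G y - 'D_h G (seg a x s)|)//.
  by rewrite ler_piMl// ger0_norm ?exprn_ge0// exprn_ile1.
rewrite !(@derive_sum_partial _ _ G _ h); [|by apply/dG/Ustar|exact: dG].
rewrite /dotc -sumrB (le_trans (ler_norm_sum _ _ _))//.
rewrite (@le_trans _ _ (\sum_(i < n) `|h| * (e / n.+1%:R)))//.
  apply: ler_sum => i _; rewrite -mulrBr normrM ler_pM// ?le_row_norm//.
  apply: Gd => //; by rewrite (le_lt_trans (seg_ball _ t01)).
rewrite sumr_const card_ord -mulrnAr mulrC ler_wpM2r//.
rewrite -mulr_natr -mulrA ler_piMr ?ltW//.
by rewrite mulrC ltr_pdivrMr// mul1r ltr_nat.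
Unshelve. all: by end_near. Qed.

Lemma seg_avg_smooth k (G : V -> R^o) :
  smooth_on U G -> smooth_on U (seg_avg k G).
Proof.
move=> Gs m; elim: m k G Gs => [|m IH] k G Gs.
  move=> x Ux; apply: differentiable_continuous.
  apply: (seg_avg_derive k Ux _ _).1 => [y|v y].
    exact: smooth_on_differentiable.
  by apply: smooth_on_continuous; exact: smooth_on_derive.
have H x (Ux : U x) := seg_avg_derive k Ux
  (fun y => @smooth_on_differentiable _ _ _ _ _ y Gs)
  (fun v y => @smooth_on_continuous _ _ _ _ _ y (smooth_on_derive v Gs)).
split=> [x Ux|v]; first exact: (H x Ux).1.
apply: Ck_eq (IH k.+1 _ (smooth_on_derive v Gs)) => // x Ux.
by rewrite (H x Ux).2.
Qed.

(** The segment from [a] to itself is constant. Hence Hadamard's coefficients take at the base point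
    the values of the partial derivatives. *)
Lemma seg_avg_base (G : V -> R^o) : seg_avg 0 G a = G a.
Proof.
transitivity (\int[mu]_(s in I01) G a).
  by apply: eq_Rintegral => s _; rewrite expr0 mul1r /seg subrr scaler0 addr0.
rewrite Rintegral_cst//; have := @lebesgue_measure_itv R `[0%R, 1%R].
by rewrite /= lte_fin ltr01 => ->; rewrite oppr0 adde0 mulr1.
Qed.

(** The difference G x - G a is the integral of the derivative along the segment, which
    [seg_avg_linear] splits into coordinates. The coefficients are smooth in x by
    [seg_avg_smooth]. *)
Lemma hadamard (G : V -> R^o) x : smooth_on U G -> U x ->
  G x = G a + \sum_i (x - a) 0 i * seg_avg 0 ('D_(delta_mx 0 i) G) x.
Proof.
move=> Gs Ux.
have dG y : U y -> differentiable G y by exact: smooth_on_differentiable.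
have DGc v y : U y -> {for y, continuous ('D_v G)}.
  by apply: smooth_on_continuous; exact: smooth_on_derive.
rewrite -[X in _ + X](seg_avg_linear _ _ Ux dG DGc).
have dp (t : R) : is_diff t (seg a x : R -> V) ( *:%R^~ (x - a)).
  have -> : ( *:%R^~ (x - a) : R -> V) = 0 + *:%R^~ (x - a) by rewrite add0r.
  exact: is_diffD.
have dGp (t : R) : 0 <= t <= 1 ->
    is_derive t 1 (G \o seg a x) ('D_(x - a) G (seg a x t)).
  move=> t01; have dGt := dG _ (Ustar Ux t01).
  have d : differentiable (G \o seg a x) t by exact: differentiable_comp.
  apply: DeriveDef; first exact: diff_derivable.
  by rewrite !deriveE// diff_comp//= diff_val scale1r.
have Gpc (t : R) : 0 <= t <= 1 -> {for t, continuous (G \o seg a x)}.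
  move=> t01; apply/differentiable_continuous/derivable1_diffP.
  by have [] := dGp _ t01.
have E : (\int[mu]_(t in I01) ('D_(x - a) G (seg a x t))%:E =
    ((G \o seg a x) 1)%:E - ((G \o seg a x) 0)%:E)%E.
  apply: (@continuous_FTC2 _ _ (G \o seg a x) 0 1 ltr01).
  - apply: continuous_in_subspaceT => t /set_mem; rewrite /= in_itv/= => t01.
    apply: (@cvg_comp _ _ _ (seg a x) ('D_(x - a) G)); first exact: seg_continuous.
    exact: (DGc _ _ (Ustar Ux t01)).
  - split.
    + by move=> t; rewrite in_itv/= => /andP[t0 t1]; have [] := dGp t; rewrite ?ltW.
    + by apply: cvg_at_right_filter; apply: Gpc; rewrite lexx ler01.
    + by apply: cvg_at_left_filter; apply: Gpc; rewrite lexx ler01.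
  - move=> t; rewrite in_itv/= => /andP[t0 t1]; rewrite derive1E.
    by have [|_] := dGp t; first by rewrite !ltW.
have -> : seg_avg 0 ('D_(x - a) G) x = G x - G a.
  transitivity (fine (\int[mu]_(t in I01) ('D_(x - a) G (seg a x t))%:E)).
    by rewrite /seg_avg; under eq_Rintegral do rewrite expr0 mul1r.
  by rewrite E /= /seg scale1r scale0r addr0 subrKC.
by rewrite subrKC.
Qed.
End SegmentAverage.

(** * Operations on smooth functions *)

Section SmoothOnAlgebra.
Variables (R : realType) (V : normedModType R) (U : set V).
Hypothesis Uo : open U.
Implicit Types f g : V -> R^o.

Lemma smooth_on_cst (a : R) : smooth_on U (cst a : V -> R^o).
Proof. by move=> k; exact: (Ck_cst Uo). Qed.

Lemma smooth_on_add f g : smooth_on U f -> smooth_on U g -> smooth_on U (f + g).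
Proof. by move=> fs gs k; exact: (Ck_add Uo (fs k) (gs k)). Qed.

Lemma smooth_on_mul f g : smooth_on U f -> smooth_on U g -> smooth_on U (f * g).
Proof. by move=> fs gs k; exact: (Ck_mul Uo (fs k) (gs k)). Qed.

Lemma smooth_on_sum n (f : 'I_n -> V -> R^o) :
  (forall i, smooth_on U (f i)) -> smooth_on U (\sum_i f i).
Proof.
move=> fs; elim/big_ind : _ => [||i _]; last exact: fs.
- exact: smooth_on_cst.
- exact: smooth_on_add.
Qed.

(** The derivative -(1/f)(1/f) D_v f involves only 1/f itself and a smooth factor, so regularity of
    1/f improves by one order at each step. *)
Lemma smooth_on_inv f : (forall x, U x -> f x != 0) -> smooth_on U f ->
  smooth_on U (fun x => (f x)^-1 : R^o).
Proof.
move=> f0 fs; elim=> [|k IH].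
  by move=> x Ux; apply: cvgV; [exact: f0|exact: (smooth_on_continuous fs Ux)].
split=> [x Ux|v].
  by apply: differentiableV; [exact: (smooth_on_differentiable fs Ux)|exact: f0].
have := Ck_mul Uo (Ck_mul Uo (Ck_mul Uo (smooth_on_cst (-1) k) IH) IH)
  (smooth_on_derive v fs k).
apply: (Ck_eq Uo) => x Ux.
have dfx := diff_derivable (v := v) (smooth_on_differentiable fs Ux).
rewrite deriveV//; last exact: f0.
by rewrite !fctE mulN1r mulNr -invfM -expr2.
Qed.

Lemma smooth_on_comp1 (h : R^o -> R^o) f : smooth_on setT h -> smooth_on U f ->
  smooth_on U (h \o f).
Proof.
move=> + fs k; elim: k h => [|k IH] h hs.
  move=> x Ux; apply: continuous_comp; first exact: (smooth_on_continuous fs Ux).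
  exact: (smooth_on_continuous hs).
have df x (Ux : U x) := smooth_on_differentiable fs Ux.
have dh x := @smooth_on_differentiable _ _ _ _ _ x hs I.
split=> [x Ux|v]; first exact: (differentiable_comp (df x Ux) (dh _)).
have := Ck_mul Uo (IH _ (smooth_on_derive (1 : R^o) hs)) (smooth_on_derive v fs k).
apply: (Ck_eq Uo) => x Ux; have dfx := df x Ux.
rewrite [RHS]deriveE; last exact: (differentiable_comp (df x Ux) (dh _)).
rewrite diff_comp// !fctE /= !deriveE//.
by rewrite -[X in _ = 'd h _ X]mulr1 [RHS]linearZ /= mulrC.
Qed.

End SmoothOnAlgebra.

Section Coordinates.
Variables (R : realType) (n : nat).
Local Notation E := 'rV[R]_n.

Lemma derive_coord (V : normedModType R) (g : V -> E) x v i :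
  differentiable g x -> differentiable (fun y => g y 0 i : R^o) x /\
  'D_v (fun y => g y 0 i : R^o) x = 'D_v g x 0 i.
Proof.
move=> dg; split.
  apply: (differentiable_comp (g := fun y : E => y 0 i : R^o) dg).
  exact: differentiable_coord.
by rewrite derive_mx ?mxE//; exact: diff_derivable.
Qed.

Lemma smooth_on_coord (U : set E) i : open U ->
  smooth_on U (fun x : E => x 0 i : R^o).
Proof.
move=> Uo; have dx (x : E) : differentiable (fun x : E => x 0 i : R^o) x.
  exact: differentiable_coord.
case=> [|k]; first by move=> x _; exact: coord_continuous.
split=> [x _|v]; first exact: dx.
apply: (Ck_eq Uo) (smooth_on_cst Uo (v 0 i) k) => x Ux.
have d1 : differentiable (id : E -> E) x by [].
by rewrite (derive_coord v i d1).2 derive_id.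
Qed.

Lemma Ck_coord (V : normedModType R) (U : set V) (g : V -> E) k i : open U ->
  Ck k U g -> Ck k U (fun x => g x 0 i : R^o).
Proof.
move=> Uo; elim: k g => [|k IH] g.
  move=> gc x Ux; apply: (@cvg_comp _ _ _ g (fun y : E => y 0 i)); first exact: gc.
  exact: coord_continuous.
move=> [dg Dg]; split=> [x Ux|v].
  exact: (derive_coord 0 i (dg x Ux)).1.
by apply: (Ck_eq Uo) (IH _ (Dg v)) => x Ux; rewrite (derive_coord _ _ (dg x Ux)).2.
Qed.

Lemma smooth_on_comp (V : normedModType R) (U : set V) (U' : set E)
    (f : E -> R^o) (g : V -> E) :
  open U -> (forall x, U x -> U' (g x)) ->
  smooth_on U' f -> smooth_on U g -> smooth_on U (f \o g).
Proof.
move=> Uo UU' + gs k; elim: k f => [|k IH] f fs.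
  move=> x Ux; apply: continuous_comp; first exact: (smooth_on_continuous gs Ux).
  exact: (smooth_on_continuous fs (UU' x Ux)).
have dg x (Ux : U x) := smooth_on_differentiable gs Ux.
have df x (Ux : U x) := smooth_on_differentiable fs (UU' _ Ux).
split=> [x Ux|v]; first exact: (differentiable_comp (dg x Ux) (df _ _)).
have : Ck k U (\sum_i
    (fun x => 'D_v g x 0 i : R^o) * ('D_(delta_mx 0 i) f \o g) : V -> R^o).
  elim/big_ind : _ => [||i _]; [exact: (Ck_cst Uo)|by move=> ? ?; exact: Ck_add|].
  apply: (Ck_mul Uo); first exact/Ck_coord/smooth_on_derive.
  exact/IH/smooth_on_derive.
apply: (Ck_eq Uo) => x Ux; have dgx := dg x Ux; have dfx := df x Ux.
rewrite [RHS]deriveE; last exact: differentiable_comp.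
rewrite diff_comp//= -!deriveE// derive_sum_partial// /dotc fct_sumE.
by apply: eq_bigr.
Qed.

End Coordinates.

(** * Bump functions *)

Section FlatFunction.
Variable R : realType.
Implicit Types (p : {poly R}) (x t : R).

(* P(1/x) exp(-1/x): the polynomial factor makes the class stable under
   differentiation. *)
Definition flat p x : R := if 0 < x then p.[x^-1] * expR (- x^-1) else 0.

(** With t = 1/x >= 1 and m the size of p, the polynomial is at most K t^m while exp(t) >= t^(m+2) /
    (m+2)!. The two spare powers make the difference quotient at 0 tend to 0. *)
Lemma flat_le_sqr p : exists2 C, 0 <= C &
  forall x, `|x| <= 1 -> `|flat p x| <= C * x ^+ 2.
Proof.
pose m := size p; pose K := \sum_(i < m) `|p`_i|.
have K0 : 0 <= K by exact: sumr_ge0.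
exists (K * (m.+2)`!%:R); first exact: mulr_ge0.
move=> x x1; rewrite /flat; case: ifPn => [x0|_]; last first.
  by rewrite normr0; apply: mulr_ge0; [exact: mulr_ge0|exact: sqr_ge0].
set t := x^-1; have t1 : 1 <= t.
  by rewrite /t -invr1 lef_pV2 ?posrE// (le_trans (ler_norm _)).
have t0 : 0 < t by rewrite (lt_le_trans ltr01).
have pK : `|p.[t]| <= K * t ^+ m.
  rewrite horner_coef (le_trans (ler_norm_sum _ _ _))// mulr_suml ler_sum// => i _.
  by rewrite normrM ler_wpM2l// normrX gtr0_norm// ler_weXn2l// ltnW.
have eK : expR (- t) <= (m.+2)`!%:R * t ^- m.+2.
  rewrite expRN -[leRHS]invrK lef_pV2 ?posrE ?expR_gt0//; last first.
    by rewrite invr_gt0 mulr_gt0// ?ltr0n ?fact_gt0// invr_gt0 exprn_gt0.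
  rewrite invfM invrK mulrC (le_trans _ (expR_ge1Dxn m.+1 (ltW t0)))//.
  by rewrite lerDr.
rewrite normrM [`|expR _|]ger0_norm ?expR_ge0//.
rewrite (le_trans (ler_pM _ _ pK eK)) ?expR_ge0// mulrACA ler_wpM2l//.
  exact: mulr_ge0.
by rewrite -[m.+2]addn2 exprD invfM mulrA divff ?mul1r ?expf_neq0 ?gt_eqF//
  /t exprVn invrK.
Qed.

(** In the variable t = 1/x one has d/dx = -t^2 d/dt, which sends p(t) exp(-t) to t^2 (p - p')(t)
    exp(-t). *)
Lemma is_derive_flat p x :
  is_derive x 1 (flat p : R^o -> R^o) (flat ('X^2 * (p - p^`())) x).
Proof.
have [x0|x0|->] := ltgtP x 0.
- have -> : flat ('X^2 * (p - p^`())) x = 0 by rewrite /flat ltNge ltW.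
  apply: (@near_eq_is_derive R R^o R^o (cst 0)).
  near=> y; rewrite /flat ifN// -leNgt ltW//.
  by near: y; exact: lt_nbhsl.
- apply: (@near_eq_is_derive R R^o R^o (fun y => p.[y^-1] * expR (- y^-1))).
    near=> y; rewrite /flat ifT//.
    by near: y; exact: lt_nbhsr.
  have xn0 : x != 0 by rewrite gt_eqF.
  have dV : is_derive x 1 (fun y : R => y^-1) (- x ^- 2).
    have -> : - x ^- 2 = - (id x) ^- 2 *: (1 : R) by rewrite [_ *: _]mulr1.
    by apply: is_deriveV; first exact: xn0.
  have d1 := is_derive1_comp (is_derive_poly p x^-1) dV.
  have dN : is_derive x 1 (fun y : R => - y^-1) (- - x ^- 2).
    exact: is_deriveN dV.
  have d2 := @is_derive1_comp _ expR (fun y => - y^-1) _ _ _ (is_derive_expR _) dN.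
  have D := is_deriveM d1 d2; apply: (is_derive_eq D).
  rewrite /flat x0 !hornerE /= /GRing.scale /= exprVn opprK; ring.
- rewrite /flat ltxx.
  have [C C0 fC] := flat_le_sqr p.
  have L : h^-1 *: (flat p (h *: (1 : R^o) + 0) - flat p 0) @[h --> 0^'] --> (0 : R^o).
    apply/cvgr0Pnorm_le => e e0; near=> h.
    have h0 : h != 0 by near: h; exact: nbhs_dnbhs_neq.
    have h1 : `|h| <= 1 by near: h; apply: dnbhs0_le.
    have he : `|h| <= e / (C + 1).
      by near: h; apply: dnbhs0_le; rewrite divr_gt0// ltr_wpDl.
    rewrite addr0 [h *: _]mulr1 {2}/flat ltxx subr0 normrM normfV.
    rewrite ler_pdivrMl ?normr_gt0// (le_trans (fC _ h1))//.
    rewrite -(real_normK (num_real h)) expr2 mulrCA ler_wpM2l//.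
    rewrite (le_trans (ler_wpM2l C0 he))// mulrCA ler_piMr ?(ltW e0)//.
    by rewrite ler_pdivrMr ?mul1r ?lerDl// ltr_wpDl.
  by apply: DeriveDef; [exact: cvgP L|exact: cvg_lim L].
Unshelve. all: by end_near. Qed.

Lemma smooth_flat p : smooth_on setT (flat p : R^o -> R^o).
Proof.
move=> k; elim: k p => [|k IH] p.
  move=> x _; apply/differentiable_continuous/derivable1_diffP.
  by have [] := is_derive_flat p x.
have df x : differentiable (flat p : R^o -> R^o) x.
  by apply/derivable1_diffP; have [] := is_derive_flat p x.
split=> // v.
have := Ck_mul openT (smooth_on_cst openT (v : R) k) (IH ('X^2 * (p - p^`()))).
apply: (Ck_eq openT) => x _; rewrite fctE.
rewrite [RHS]deriveE// -[X in 'd _ _ X]mulr1 [RHS]linearZ/= -deriveE//.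
by have [_ ->] := is_derive_flat p x.
Qed.

End FlatFunction.

(** The squared Euclidean distance [rho] is polynomial, unlike the max norm of row vectors, whose
    square it dominates. The quotient [N / D] is 1 where rho <= r^2/3 and 0 where rho >= 2 r^2/3;
    since 1/3 < 2/3, the two terms of [D] never vanish together. *)
Lemma euclidean_bump (R : realType) (n : nat) (a : 'rV[R]_n) (r : R) : 0 < r ->
  exists G : 'rV[R]_n -> R^o, [/\ smooth_on setT G,
    \forall x \near a, G x = 1 & forall x, G x != 0 -> `|x - a| <= r].
Proof.
move=> r0; pose h := flat (1 : {poly R}).
have h_gt0 s : 0 < s -> 0 < h s.
  by move=> s0; rewrite /h /flat s0 hornerE mul1r expR_gt0.
have h_le0 s : s <= 0 -> h s = 0 by rewrite /h /flat ltNge => ->.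
have h_ge0 s : 0 <= h s.
  by have [/h_le0->//|/h_gt0/ltW] := leP s 0.
pose rho (x : 'rV[R]_n) : R^o := \sum_i (x 0 i - a 0 i) ^+ 2.
pose u := r ^+ 2.
pose N (x : 'rV[R]_n) : R^o := h (2 / 3 * u - rho x).
pose D (x : 'rV[R]_n) : R^o := N x + h (rho x - 1 / 3 * u).
have u0 : 0 < u by exact: exprn_gt0.
have oT := @openT 'rV[R]_n.
have rhos : smooth_on setT rho.
  have -> : rho = \sum_i ((fun x : 'rV[R]_n => x 0 i : R^o) + cst (- a 0 i)) *
      ((fun x : 'rV[R]_n => x 0 i : R^o) + cst (- a 0 i)).
    by apply/funext => x; rewrite fct_sumE; apply: eq_bigr => i _; rewrite expr2.
  apply: (smooth_on_sum oT) => i; apply: (smooth_on_mul oT);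
    by apply: (smooth_on_add oT); [exact: smooth_on_coord|exact: smooth_on_cst].
have Ns : smooth_on setT N.
  have -> : N = h \o (cst (2 / 3 * u) + cst (- 1) * rho).
    by apply/funext => x; rewrite /N /= !fctE mulN1r.
  apply: (smooth_on_comp1 oT); first exact: smooth_flat.
  apply: (smooth_on_add oT); first exact: (smooth_on_cst oT).
  by apply: (smooth_on_mul oT); first exact: (smooth_on_cst oT).
have Ds : smooth_on setT D.
  have -> : D = N + ((fun s : R^o => h s : R^o) \o (rho + cst (- (1 / 3 * u)))) by [].
  apply: (smooth_on_add oT) => //; apply: (smooth_on_comp1 oT).
    exact: smooth_flat.
  by apply: (smooth_on_add oT) => //; exact: (smooth_on_cst oT).
have D0 x : D x != 0.
  rewrite gt_eqF// /D /N; have [rx|rx] := ltP (rho x) (2 / 3 * u).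
    by rewrite ltr_wpDr// h_gt0// subr_gt0.
  by rewrite ltr_wpDl// h_gt0// subr_gt0 (lt_le_trans _ rx)// ltr_pM2r//; lra.
exists (N * (fun x => (D x)^-1)); split.
- apply: (smooth_on_mul oT) => //; exact: (smooth_on_inv oT).
- have : rho x @[x --> a] --> rho a by exact: smooth_on_continuous rhos I.
  have -> : rho a = 0 by rewrite /rho big1// => i _; rewrite subrr expr0n.
  move=> /cvgr_lt/(_ (1 / 3 * u)) H; near=> x.
  have DN : D x = N x.
    rewrite /D h_le0 ?addr0// subr_le0 ltW//.
    by near: x; apply: H; rewrite mulr_gt0//; lra.
  by rewrite fctE DN divff// -DN.
- move=> x; rewrite fctE mulf_eq0 negb_or => /andP[Nx _].
  have rx : rho x < u.
    rewrite ltNge; apply: contra Nx => ux; rewrite /N h_le0// subr_le0.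
    by rewrite (le_trans _ ux)// ler_piMl ?ltW//; lra.
  have -> : `|x - a| = mx_norm (x - a) by [].
  rewrite mx_normrE; apply: bigmax_le; first exact: ltW.
  move=> [i j] _; rewrite ord1 !mxE /=.
  rewrite -(@ler_pXn2r _ 2)// ?nnegrE ?(ltW r0)// real_normK ?num_real//.
  rewrite (le_trans _ (ltW rx))// /rho (bigD1 j)//= lerDl sumr_ge0// => k _.
  exact: sqr_ge0.
Unshelve. all: by end_near. Qed.

(** * Functions and vector fields on a manifold *)

Section ManifoldFunctions.
Variables (R : realType) (n : nat) (M : manifold R n).
Local Notation E := 'rV[R]_n.
Implicit Types (p q : M) (c d : chart R n M).

Lemma chart_open_image c (W : set M) : open W ->
  open (chart_map c @` (chart_dom c `&` W)).
Proof.
move=> Wo; rewrite openE => _ [p [cp Wp] <-].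
have ci : (chart_map c @` chart_dom c) (chart_map c p) by exists p.
have inv_c := @chart_inv_continuous _ _ _ c (chart_map c p) (mem_set ci).
have : \forall y \near chart_map c p, (chart_dom c `&` W) (chart_inv c y).
  apply: inv_c; rewrite chart_mapK ?inE//.
  apply: open_nbhs_nbhs; split=> //.
  by apply: openI => //; exact: chart_dom_open.
have : \forall y \near chart_map c p, (chart_map c @` chart_dom c) y.
  by apply: open_nbhs_nbhs; split=> //; exact: chart_img_open.
by apply: filterS2 => _ [q cq <-]; rewrite chart_mapK ?inE.
Qed.

Lemma chart_open_preimage c (U : set E) : open U ->
  open (chart_dom c `&` chart_map c @^-1` U).
Proof.
move=> Uo; rewrite openE => p [cp Up].
apply: filterI; first exact: open_nbhs_nbhs (conj (chart_dom_open c) cp).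
have := @chart_map_continuous _ _ _ c p (mem_set cp).
by apply; exact: open_nbhs_nbhs.
Qed.

(** While [smooth] tests all charts of the atlas, smoothness of the transition maps reduces this to
    one chart around each point. *)
Lemma smooth_chartwise (f : M -> R) :
  (forall p, exists c W, [/\ atlas c, open W, W p, W `<=` chart_dom c &
     smooth_on (chart_map c @` W) (f \o chart_inv c : E -> R^o)]) ->
  smooth f.
Proof.
move=> floc d dA k; apply: Ck_local => _ [p dp <-].
have [c [W [cA Wo Wp Wc fs]]] := floc p.
exists (chart_map d @` (chart_dom d `&` W)); first by exists p.
have Uo := chart_open_image (c := d) Wo.
have Hs : smooth_on (chart_map d @` (chart_dom d `&` W))
    ((f \o chart_inv c : E -> R^o) \o (chart_map c \o chart_inv d)).
  apply: (smooth_on_comp Uo _ fs) => [_ [q [dq Wq] <-] /=|j].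
    by rewrite chart_mapK ?inE//; exists q.
  apply: Ck_subset (atlas_compatible dA cA j) => _ [q [dq Wq] <-].
  by exists q => //; split=> //; exact: Wc.
apply: (Ck_eq Uo) (Hs k) => _ [q [dq Wq] <-] /=.
by rewrite chart_mapK ?inE// chart_mapK ?inE//; exact: Wc.
Qed.

Lemma smooth_near (f : M -> R) :
  (forall p, exists2 f' : M -> R, smooth f' & \forall q \near p, f q = f' q) ->
  smooth f.
Proof.
move=> floc; apply: smooth_chartwise => p.
have [f' f's nf] := floc p.
have [W [Wo Wp] Wf] : exists2 W, open_nbhs p W & W `<=` [set q | f q = f' q].
  by move: nf; rewrite /prop_near1 nbhsE.
have [c cA cp] := atlas_cover p.
exists c, (chart_dom c `&` W); split=> //.
- by apply: openI => //; exact: chart_dom_open.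
- move=> k.
  apply: Ck_eq (Ck_subset _ (f's c cA k)).
  + exact: chart_open_image.
  + by move=> _ [q [cq Wq] <-] /=; rewrite chart_mapK ?inE// Wf.
  + by move=> _ [q [cq Wq] <-]; exists q.
Qed.

(** Extension by zero. The Hausdorff axiom enters here: the compact image of [K] in M is closed, so
    f vanishes on an open neighbourhood of every point outside the domain of [G]. *)
Lemma smooth_extension c (U K : set E) (G : E -> R^o) (f : M -> R) :
  atlas c -> open U -> U `<=` chart_map c @` chart_dom c ->
  compact K -> K `<=` U -> smooth_on U G ->
  (forall q, chart_dom c q -> U (chart_map c q) -> f q = G (chart_map c q)) ->
  (forall q, ~ (chart_dom c q /\ K (chart_map c q)) -> f q = 0) ->
  smooth f.
Proof.
move=> cA Uo Uc Kc KU Gs fG f0; apply: smooth_chartwise => p.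
have [[cp Up]|ncp] := pselect (chart_dom c p /\ U (chart_map c p)).
  exists c, (chart_dom c `&` chart_map c @^-1` U); split=> //.
  - exact: chart_open_preimage.
  - move=> k; apply: Ck_eq (Ck_subset _ (Gs k)).
    + rewrite -[X in X `&` _]setIid -setIA; apply: chart_open_image.
      exact: chart_open_preimage.
    + by move=> _ [q [cq Uq] <-] /=; rewrite chart_mapK ?inE// fG.
    + by move=> _ [q [cq Uq] <-].
have cK : closed (chart_inv c @` K).
  apply: compact_closed; first exact: hausdorff_carrier.
  apply: continuous_compact => //.
  apply: continuous_in_subspaceT => x /set_mem/KU/Uc xc.
  by apply: chart_inv_continuous; exact: mem_set.
have [d dA dp] := atlas_cover p.
exists d, (chart_dom d `&` ~` (chart_inv c @` K)); split=> //.
- by apply: openI; [exact: chart_dom_open|exact: closed_openC].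
- split=> // -[x Kx xp]; apply: ncp.
  have [q cq qx] := Uc _ (KU _ Kx).
  have <- : q = p by rewrite -xp -qx chart_mapK ?inE.
  by rewrite qx; split=> //; exact: KU.
- move=> k; apply: Ck_eq (@Ck_cst _ _ _ _ k 0).
  + by apply: chart_open_image; exact: closed_openC.
  + move=> _ [q [dq Kq] <-] /=; rewrite chart_mapK ?inE// f0// => -[cq Kcq].
    by apply: Kq; exists (chart_map c q) => //; rewrite chart_mapK ?inE.
  + by apply: chart_open_image; exact: closed_openC.
Qed.

End ManifoldFunctions.

Lemma compact_bump (R : realType) (n : nat) (U : set 'rV[R]_n) a :
  open U -> U a -> exists (G : 'rV[R]_n -> R^o) (K : set 'rV[R]_n),
  [/\ smooth_on setT G, \forall x \near a, G x = 1,
      compact K, K `<=` U & forall x, ~ K x -> G x = 0].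
Proof.
move=> Uo Ua; have : \forall x \near a, U x by exact: open_nbhs_nbhs.
move=> /nbhs_closedballP [r rU].
have [G [Gs G1 G0]] := euclidean_bump a (r := r%:num) [gt0 of r%:num].
exists G, (closed_ball a r%:num); split=> //.
  apply: bounded_closed_compact.
    exists (`|a| + r%:num); split; first exact: num_real.
    move=> m am x; rewrite closed_ballE// /closed_ball_ /= => xr.
    rewrite (le_trans _ (ltW am))// -[x](subKr a) (le_trans (ler_normB _ _))//.
    by rewrite lerD2l.
  exact: closed_ball_closed.
move=> x Kx; apply: contra_notP Kx => /eqP /G0.
by rewrite closed_ballE// /closed_ball_ /= distrC.
Qed.

Section Cutoff.
Variables (R : realType) (n : nat) (M : manifold R n).
Local Notation E := 'rV[R]_n.
Local Notation C := (smoothfun M).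

(** The map [chart_map c] is total with unspecified values off [chart_dom c], hence the explicit
    test. [F] may be arbitrary where [G] vanishes. *)
Definition cutoff (c : chart R n M) (G F : E -> R^o) (q : M) : R :=
  if `[< chart_dom c q >] then G (chart_map c q) * F (chart_map c q) else 0.

Lemma smooth_cutoff c (U K : set E) G F : atlas c -> open U ->
  U `<=` chart_map c @` chart_dom c -> compact K -> K `<=` U ->
  smooth_on setT G -> (forall x, ~ K x -> G x = 0) -> smooth_on U F ->
  smooth (cutoff c G F).
Proof.
move=> cA Uo Uc Kc KU Gs G0 Fs.
apply: (smooth_extension cA Uo Uc Kc KU (smooth_on_mul Uo _ Fs)).
- by move=> k; exact: Ck_subset (Gs k).
- by move=> q cq Uq; rewrite /cutoff asboolT.
- move=> q cKq; rewrite /cutoff; case: asboolP => // cq.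
  by rewrite G0 ?mul0r// => Kq; apply: cKq.
Qed.

Definition mk_smooth (f : M -> R) (fs : smooth f) : C := SmoothFun (asboolT fs).

Lemma smoothfunP (f : C) : smooth f.
Proof. by case: f => f /= /asboolP. Qed.

Lemma smoothfun_on (f : C) c : atlas c ->
  smooth_on (chart_map c @` chart_dom c) (f \o chart_inv c : E -> R^o).
Proof. exact: smoothfunP. Qed.

Lemma smoothfun_eq (f g : C) : (forall q, f q = g q) -> f = g.
Proof. by move=> fg; apply/val_inj/funext. Qed.

Lemma smoothfunD (f g : C) q : (f + g) q = f q + g q. Proof. by []. Qed.
Lemma smoothfunN (f : C) q : (- f) q = - f q. Proof. by []. Qed.
Lemma smoothfunM (f g : C) q : (f * g) q = f q * g q. Proof. by []. Qed.
Lemma smoothfunZ a (f : C) q : (a *: f) q = a * f q. Proof. by []. Qed.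
Lemma smoothfun1 q : (1 : C) q = 1. Proof. by []. Qed.
Lemma smoothfun_sum (I : Type) (r : seq I) (P : pred I) (f : I -> C) q :
  (\sum_(i <- r | P i) f i) q = \sum_(i <- r | P i) f i q.
Proof. by apply: (big_morph (fun f : C => f q)). Qed.

Lemma vfieldP (X : vfield M) : linear (X : C -> C) /\ leibniz X.
Proof. by case: X => X /= /asboolP. Qed.

Lemma vfieldD (X : vfield M) (f g : C) : X (f + g) = X f + X g.
Proof. by have [/(_ 1 f g)] := vfieldP X; rewrite !scale1r. Qed.
Lemma vfield_scale (X : vfield M) a (f : C) : X (a *: f) = a *: (X f : C).
Proof.
have [l _] := vfieldP X; have X0 : X 0 = 0.
  by have := l (-1) 0 0; rewrite scaler0 addr0 scaleN1r addNr.
by have := l a f 0; rewrite X0 !addr0.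
Qed.
Lemma vfieldM (X : vfield M) (f g : C) : X (f * g) = X f * g + f * X g.
Proof. by have [_] := vfieldP X; apply. Qed.
Lemma vfield1 (X : vfield M) : X 1 = 0.
Proof.
have := vfieldM X 1 1; rewrite !mulr1 mul1r => /eqP.
by rewrite -subr_eq subrr eq_sym => /eqP.
Qed.
Lemma vfield_sum (X : vfield M) (I : Type) (r : seq I) (P : pred I)
    (f : I -> C) :
  X (\sum_(i <- r | P i) f i) = \sum_(i <- r | P i) (X (f i) : C).
Proof.
apply: (big_morph (X : C -> C)); first exact: vfieldD.
by have := vfield_scale X 0 0; rewrite !scale0r.
Qed.
Lemma vfield_centered (X : vfield M) (f g : C) q : g q = 0 ->
  (X (f * g) : C) q = f q * (X g : C) q.
Proof. by move=> g0; rewrite vfieldM smoothfunD !smoothfunM g0 mulr0 add0r. Qed.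
Lemma vfield_subc (X : vfield M) (f : C) (a : R) : X (f - a *: (1 : C)) = X f.
Proof. by rewrite -scaleNr vfieldD vfield_scale vfield1 scaler0 addr0. Qed.
Lemma vfield_eq (X Y : vfield M) :
  (forall f q, (X f : C) q = (Y f : C) q) -> X = Y.
Proof.
by move=> XY; apply/val_inj/funext => f /=; apply: smoothfun_eq => q; exact: XY.
Qed.

Lemma vfield_addE (X Y : vfield M) (f : C) : (X + Y) f = X f + Y f.
Proof. by []. Qed.
Lemma vfield_oppE (X : vfield M) (f : C) : (- X) f = - X f.
Proof. by []. Qed.
Lemma vfield_scaleE (h : C) (X : vfield M) (f : C) : (h *: X) f = h * X f.
Proof. by []. Qed.
Lemma vfield_sumE (I : Type) (r : seq I) (P : pred I) (X : I -> vfield M)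
    (f : C) :
  (\sum_(i <- r | P i) X i) f = \sum_(i <- r | P i) X i f.
Proof. by apply: (big_morph (fun X : vfield M => X f)). Qed.

End Cutoff.

(** * Coordinate fields and local frames *)

Section LocalFrame.
Variables (R : realType) (n : nat) (M : manifold R n).
Local Notation E := 'rV[R]_n.
Local Notation C := (smoothfun M).
Local Notation V := (vfield M).

Lemma chart_near (c : chart R n M) p (P : E -> Prop) : chart_dom c p ->
  (\forall x \near chart_map c p, P x) -> \forall q \near p, P (chart_map c q).
Proof. by move=> cp; exact: (chart_map_continuous (mem_set cp)). Qed.

Lemma chart_dom_near (c : chart R n M) p : chart_dom c p ->
  \forall q \near p, chart_dom c q.
Proof.
by move=> cp; apply: open_nbhs_nbhs; split=> //; exact: chart_dom_open.
Qed.

Section CoordinateField.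
Variables (c : chart R n M) (cA : atlas c) (G : E -> R^o) (K : set E).
Hypotheses (Kc : compact K) (KU : K `<=` chart_map c @` chart_dom c).
Hypotheses (Gs : smooth_on setT G) (G0 : forall x, ~ K x -> G x = 0).

Lemma coord_field_smooth v (f : C) :
  smooth (cutoff c G ('D_v (f \o chart_inv c : E -> R^o))).
Proof.
apply: (smooth_cutoff cA (@chart_img_open _ _ _ c) _ Kc KU Gs G0) => //.
exact/smooth_on_derive/smoothfun_on.
Qed.

(** The factor [G] makes the coordinate derivative act on global functions; where [G] is 1 it is the
    true one. *)
Definition coord_deriv v (f : C) : C^o := mk_smooth (coord_field_smooth v f).

Lemma coord_deriv_derivation v : coord_deriv v \in derivation (M := M).
Proof.
have df (f : C) q : chart_dom c q ->
    differentiable (f \o chart_inv c : E -> R^o) (chart_map c q).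
  by move=> cq; apply: (smooth_on_differentiable (smoothfun_on f cA)); exists q.
apply/asboolP; split=> [a f g|f g]; apply: smoothfun_eq => q.
  rewrite smoothfunD smoothfunZ /= /cutoff; case: asboolP => cq; last first.
    by rewrite mulr0 addr0.
  have dfq := df f q cq; have dgq := df g q cq.
  have -> : ((a *: f + g : C) \o chart_inv c : E -> R^o) =
    a *: (f \o chart_inv c : E -> R^o) + (g \o chart_inv c : E -> R^o) by [].
  rewrite deriveD; [|by apply: derivableZ; exact: diff_derivable|
    exact: diff_derivable].
  rewrite deriveZ; last exact: diff_derivable.
  by rewrite mulrDr mulrCA.
rewrite smoothfunD !smoothfunM /= /cutoff; case: asboolP => cq; last first.
  by rewrite mulr0 mul0r addr0.
have dfq := df f q cq; have dgq := df g q cq.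
have -> : ((f * g : C) \o chart_inv c : E -> R^o) =
  (f \o chart_inv c : E -> R^o) * (g \o chart_inv c : E -> R^o) by [].
rewrite deriveM; [|exact: diff_derivable..].
rewrite /= chart_mapK ?inE// /GRing.scale /=; ring.
Qed.

Definition coord_field v : V := VField (coord_deriv_derivation v).

End CoordinateField.

(* Hadamard's lemma, multiplied by the square of a bump function [psi] with
   [psi q = 1], is an identity between global smooth functions. *)
Lemma hadamard_cutoff (c : chart R n M) q (O : set E) (x : 'I_n -> C) (f : C) :
  atlas c -> chart_dom c q -> open O -> O (chart_map c q) ->
  O `<=` chart_map c @` chart_dom c ->
  (forall i m, chart_dom c m -> O (chart_map c m) ->
    x i m = chart_map c m 0 i) ->
  exists (psi : C) (h : 'I_n -> C), [/\ psi q = 1,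
    forall i, h i q =
      'D_(delta_mx 0 i) (f \o chart_inv c : E -> R^o) (chart_map c q) &
    psi * psi * (f - f q *: (1 : C)) =
    \sum_i psi * (x i - x i q *: (1 : C)) * h i].
Proof.
move=> cA cq Oo Oq Oc xE; set a := chart_map c q.
(* Shrinking [O] to a ball gives a set star-shaped about the base point, as Hadamard's lemma
   requires. *)
have /nbhs_ballP[r /= r0 rO] : nbhs a O by exact: open_nbhs_nbhs.
have Bo : open (ball a r) by exact: ball_open.
have Ba : ball a r a by exact: ballxx.
have Bstar y (s : R) : ball a r y -> 0 <= s <= 1 -> ball a r (seg a y s).
  rewrite -ball_normE /ball_/= => yr /andP[s0 s1].
  rewrite /seg opprD addrA subrr add0r normrN normrZ distrC.
  by rewrite (le_lt_trans _ yr)// distrC ler_piMl// ger0_norm.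
have Bc : ball a r `<=` chart_map c @` chart_dom c by move=> y /rO/Oc.
have [G [K [Gs Ga Kc KB G0]]] := compact_bump Bo Ba.
have G1 : G a = 1 by exact: nbhs_singleton Ga.
pose F := f \o chart_inv c : E -> R^o.
have Fs : smooth_on (ball a r) F.
  by move=> k; apply: Ck_subset (smoothfun_on f cA k).
have hs i := seg_avg_smooth Bo Bstar 0 (smooth_on_derive (delta_mx 0 i) Fs).
(* Each coefficient carries the bump function too, which accounts for the second factor [psi] on the
   left-hand side. *)
have hS i := smooth_cutoff cA Bo Bc Kc KB Gs G0 (hs i).
have psiS := smooth_cutoff cA Bo Bc Kc KB Gs G0 (smooth_on_cst Bo 1).
exists (mk_smooth psiS), (fun i => mk_smooth (hS i)); split.
- by rewrite /= /cutoff asboolT// G1 mul1r.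
- by move=> i; rewrite /= /cutoff asboolT// G1 mul1r seg_avg_base.
apply: smoothfun_eq => m; rewrite smoothfun_sum.
under eq_bigr => i _ do
  rewrite !smoothfunM smoothfunD smoothfunN smoothfunZ smoothfun1 mulr1.
rewrite !smoothfunM smoothfunD smoothfunN smoothfunZ smoothfun1 mulr1 /= /cutoff.
case: asboolP => cm; last by rewrite !mul0r big1// => i _; rewrite !mul0r.
have [Km|Km] := pselect (K (chart_map c m)); last first.
  by rewrite G0// !mul0r big1// => i _; rewrite !mul0r.
have Bm := KB _ Km.
have := hadamard Bstar Fs Bm; rewrite /F /= !chart_mapK ?inE// => ->.
rewrite addrAC subrr add0r mulr_sumr; apply: eq_bigr => i _.
rewrite !mxE !xE//; [ring|exact: rO].
Qed.

(** The fields and coordinates are fixed once, whereas Hadamard's lemma is applied with each nearby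
    q as base point. When X acts on its identity and the result is evaluated at q, the factors f -
    f(q) and x_i - x_i(q) vanish there, so only the terms in which X differentiates them survive. *)
Lemma local_frame (p : M) : exists (e : 'I_n -> V) (x : 'I_n -> C),
  \forall q \near p, (forall i j, (e i (x j) : C) q = (i == j)%:R) /\
    forall (X : V) (f : C), (X f : C) q =
      \sum_i (X (x i) : C) q * (e i f : C) q.
Proof.
have [c cA cp] := atlas_cover p.
have Uo := @chart_img_open _ _ _ c.
have Up : (chart_map c @` chart_dom c) (chart_map c p) by exists p.
have [G [K [Gs Ga Kc KU G0]]] := compact_bump Uo Up.
(* On [O] the bump function is 1, so the cut-off coordinates and fields coincide with the genuine
   ones. *)
have [ O [Oo Op] OG] : exists2 O, open_nbhs (chart_map c p) O &
    O `<=` [set y | (chart_map c @` chart_dom c) y /\ G y = 1].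
  have : nbhs (chart_map c p) [set y | (chart_map c @` chart_dom c) y /\ G y = 1].
    by apply: filterI => //; exact: open_nbhs_nbhs.
  by rewrite nbhsE.
pose x i : C := mk_smooth (smooth_cutoff cA Uo (@subset_refl _ _) Kc KU Gs G0
  (smooth_on_coord i Uo)).
pose e i : V := coord_field cA Kc KU Gs G0 (delta_mx 0 i).
exists e, x.
have xE i m : chart_dom c m -> O (chart_map c m) -> x i m = chart_map c m 0 i.
  by move=> cm /OG[_ G1]; rewrite /= /cutoff asboolT// G1 mul1r.
have : \forall q \near p, chart_dom c q /\ O (chart_map c q).
  apply: filterI; first exact: chart_dom_near.
  by apply: (chart_near (P := O)) => //; exact: open_nbhs_nbhs.
apply: filterS => q [cq Oq]; have [_ Gq] := OG _ Oq.
have eE i (f : C) : (e i f : C) q =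
    'D_(delta_mx 0 i) (f \o chart_inv c : E -> R^o) (chart_map c q).
  by rewrite /= /cutoff asboolT// Gq mul1r.
split=> [i j|X f].
  rewrite eE.
  have -> : 'D_(delta_mx 0 i) (x j \o chart_inv c : E -> R^o) (chart_map c q) =
      'D_(delta_mx 0 i) (fun y : E => y 0 j : R^o) (chart_map c q).
    apply: near_eq_derive; have : nbhs (chart_map c q) O by exact: open_nbhs_nbhs.
    apply: filterS => y Oy; have [m cm my] := (OG _ Oy).1.
    by rewrite -my /= -xE ?chart_mapK ?inE ?my.
  have d1 : differentiable (id : E -> E) (chart_map c q) by [].
  by rewrite (derive_coord _ j d1).2 derive_id mxE eqxx eq_sym.
have Oc : O `<=` chart_map c @` chart_dom c by move=> y /OG[].
have [psi [h [psi1 hE E]]] := hadamard_cutoff f cA cq Oo Oq Oc xE.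
have := congr1 (fun g : C => (X g : C) q) E.
have c0 (g : C) : (g - g q *: (1 : C)) q = 0.
  by rewrite smoothfunD smoothfunN smoothfunZ smoothfun1 mulr1 subrr.
rewrite vfield_centered// vfield_subc smoothfunM psi1 !mul1r => ->.
rewrite vfield_sum smoothfun_sum; apply: eq_bigr => i _.
rewrite mulrAC vfield_centered// vfield_subc smoothfunM psi1 mul1r mulrC.
by rewrite hE eE.
Qed.
End LocalFrame.

(** * Duality for a Riemannian metric *)

Section Riesz.
Variables (R : realType) (n : nat) (M : manifold R n).
Local Notation E := 'rV[R]_n.
Local Notation C := (smoothfun M).
Local Notation V := (vfield M).

Lemma smooth_bump (p : M) (P : M -> Prop) : (\forall q \near p, P q) ->
  exists phi : C, phi p = 1 /\ forall q, ~ P q -> phi q = 0.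
Proof.
move=> nP; have [W [Wo Wp] WP] : exists2 W, open_nbhs p W & W `<=` P.
  by move: nP; rewrite /prop_near1 nbhsE.
have [c cA cp] := atlas_cover p.
have Uo := chart_open_image (c := c) Wo.
have Up : (chart_map c @` (chart_dom c `&` W)) (chart_map c p) by exists p.
have Uc : chart_map c @` (chart_dom c `&` W) `<=` chart_map c @` chart_dom c.
  by apply: image_subset => ? [].
have [G [K [Gs Ga Kc KU G0]]] := compact_bump Uo Up.
have S := smooth_cutoff cA Uo Uc Kc KU Gs G0 (smooth_on_cst Uo 1).
exists (mk_smooth S); rewrite /= /cutoff; split=> [|q].
  by rewrite asboolT// mulr1; exact: nbhs_singleton Ga.
apply: contra_notP; case: asboolP => // cq Gq; apply: WP.
have [r [cr Wr] rq] : (chart_map c @` (chart_dom c `&` W)) (chart_map c q).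
  by apply: KU; apply: contra_notP Gq => /G0 ->; rewrite mul0r.
suff <- : r = q by [].
by have := congr1 (chart_inv c) rq; rewrite !chart_mapK ?inE.
Qed.

Lemma smoothfun_continuous (f : C) p : f q @[q --> p] --> f p.
Proof.
have [c cA cp] := atlas_cover p.
have ip : (chart_map c @` chart_dom c) (chart_map c p) by exists p.
have fc := smooth_on_continuous (smoothfun_on f cA) ip.
have := cvg_comp _ _ (chart_map_continuous (mem_set cp)) fc.
rewrite /= chart_mapK ?inE//; apply: cvg_trans; apply: near_eq_cvg.
have := chart_dom_near cp; apply: filterS => q cq /=.
by rewrite chart_mapK ?inE.
Qed.

(* With u = d(p)^2 / 2 and h positive exactly on the positive reals, the function
   d / (d^2 + h(u - d^2)) is smooth everywhere and equal to 1/d near p. *)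
Lemma smooth_reciprocal (d : C) p : d p != 0 ->
  exists e : C, \forall q \near p, e q * d q = 1.
Proof.
move=> dp; pose h := flat (1 : {poly R}).
have h_gt0 s : 0 < s -> 0 < h s.
  by move=> s0; rewrite /h /flat s0 hornerE mul1r expR_gt0.
have h_le0 s : s <= 0 -> h s = 0 by rewrite /h /flat ltNge => ->.
have h_ge0 s : 0 <= h s.
  by have [/h_le0->//|/h_gt0/ltW] := leP s 0.
pose u := d p ^+ 2 / 2.
have d2 : 0 < d p ^+ 2 by rewrite exprn_even_gt0.
pose D q := d q ^+ 2 + h (u - d q ^+ 2).
have D0 q : D q != 0.
  rewrite gt_eqF// /D; have [->|dq] := eqVneq (d q) 0.
    by rewrite expr0n add0r subr0 h_gt0// divr_gt0.
  by rewrite ltr_wpDr// exprn_even_gt0.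
have es : smooth (fun q => d q / D q).
  move=> c cA.
  have Uo := @chart_img_open _ _ _ c.
  have ds := smoothfun_on d cA.
  pose f := d \o chart_inv c : E -> R^o.
  have d2s : smooth_on (chart_map c @` chart_dom c) (f * f) by exact: smooth_on_mul.
  apply: (smooth_on_mul Uo ds); apply: (smooth_on_inv Uo).
    by move=> x _; exact: D0.
  apply: (smooth_on_eq Uo (f := f * f +
    ((fun s => h s : R^o) \o (cst u + cst (- 1) * (f * f))))).
    by move=> x _; rewrite /D /= !fctE mulN1r -expr2.
  apply: (smooth_on_add Uo) => //.
  apply: (smooth_on_comp1 Uo); first exact: smooth_flat.
  apply: (smooth_on_add Uo); first exact: (smooth_on_cst Uo).
  apply: (smooth_on_mul Uo) => //; exact: (smooth_on_cst Uo).
exists (mk_smooth es).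
have dc : d q ^+ 2 @[q --> p] --> d p ^+ 2.
  rewrite expr2; under eq_fun do rewrite expr2.
  by apply: cvgM; exact: smoothfun_continuous.
have ud : u < d p ^+ 2 by rewrite /u; lra.
near=> q; have uq : u < d q ^+ 2 by near: q; exact: cvgr_gt dc _ ud.
have dq : d q != 0.
  apply: contraTneq uq => ->; rewrite expr0n -leNgt; exact/ltW/divr_gt0.
rewrite /= /D h_le0 ?subr_le0 ?ltW// addr0 expr2.
by rewrite invfM mulrA divff// mul1r mulVf.
Unshelve. all: by end_near. Qed.

(* C^oo(M)-linear maps are local: multiply D by a bump function. *)
Lemma scalar_local (beta : V -> C) (D : V) p : scalar beta ->
  (\forall q \near p, forall f : C, (D f : C) q = 0) -> beta D p = 0.
Proof.
move=> bl /smooth_bump[phi [phi1 phi0]].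
have E0 : phi *: D + 0 = 0.
  apply: vfield_eq => f q; rewrite addr0 vfield_scaleE smoothfunM.
  have [H|/phi0->] := pselect (forall f : C, (D f : C) q = 0); last first.
    by rewrite mul0r.
  by rewrite H mulr0.
have b0 : beta 0 = 0.
  by have := bl (-1) 0 0; rewrite scaler0 addr0 mulN1r addNr.
have := congr1 (fun g : C => g p) (bl phi D 0).
by rewrite E0 b0 addr0 smoothfunM phi1 mul1r => <-.
Qed.

Variable g : V -> V -> C.
Hypothesis gR : riemannian_metric g.

(** Packaged as a ring morphism so that a determinant of functions can be evaluated entrywise. *)
Definition eval_at (q : M) (f : C) : R := f q.
Fact eval_at_additive q : zmod_morphism (eval_at q). Proof. by []. Qed.
Fact eval_at_multiplicative q : monoid_morphism (eval_at q). Proof. by []. Qed.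
HB.instance Definition _ q :=
  GRing.isZmodMorphism.Build C R (eval_at q) (eval_at_additive q).
HB.instance Definition _ q :=
  GRing.isMonoidMorphism.Build C R (eval_at q) (eval_at_multiplicative q).

Lemma scalar_sum (beta : V -> C) (a : 'I_n -> C) (X : 'I_n -> V) :
  scalar beta -> beta (\sum_i a i *: X i) = \sum_i a i * beta (X i).
Proof.
move=> bl; have b0 : beta 0 = 0.
  by have := bl (-1) 0 0; rewrite scaler0 addr0 mulN1r addNr.
apply: (big_rec2 (fun x y => beta x = y)) => // i y x _ <-.
by rewrite bl.
Qed.

Lemma scalar_sub (beta : V -> C) X Y : scalar beta ->
  beta (X - Y) = beta X - beta Y.
Proof. by move=> bl; rewrite addrC -scaleN1r bl mulN1r addrC. Qed.

Lemma metric_nondegenerate D q : (forall X, g D X q = 0) ->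
  forall f : C, (D f : C) q = 0.
Proof.
move=> gD f; apply/eqP/negP => /negP Df.
by have [_ _ /(_ D q)] := gR; rewrite gD ltxx => /(_ (ex_intro _ f Df)).
Qed.

Lemma riesz_local (alpha : V -> C) (p : M) : scalar alpha ->
  exists Z, \forall q \near p, forall X, g Z X q = alpha X q.
Proof.
move=> al; have [[gl gr] gsym gpos] := gR.
have [e [x fr]] := local_frame p.
pose A : 'M[C]_n := \matrix_(i, j) g (e i) (e j).
have frp := nbhs_singleton fr.
(* A kernel vector of the Gram matrix at p, taken as constant coefficients, gives a field with g X X
   p = 0, although a coordinate function detects that it is nonzero at p. *)
have dA : (\det A) p != 0.
  apply/negP; rewrite -[_ p]/(eval_at p _) -det_map_mx => /det0P[v v0 vA].
  pose X := \sum_i (v 0 i *: (1 : C)) *: e i.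
  have [j vj] : exists j, v 0 j != 0.
    by apply/rV0Pn.
  have Xnz : nonzero_at X p.
    exists (x j); rewrite vfield_sumE smoothfun_sum (bigD1 j)// big1.
      rewrite vfield_scaleE smoothfunM smoothfunZ smoothfun1 mulr1 frp.1 eqxx.
      by rewrite mulr1 /= addr0.
    move=> i /andP[_ ij]; rewrite vfield_scaleE smoothfunM frp.1 (negbTE ij).
    by rewrite mulr0.
  have := gpos _ _ Xnz; suff -> : g X X p = 0 by rewrite ltxx.
  rewrite scalar_sum// smoothfun_sum big1// => j' _.
  rewrite smoothfunM (scalar_sum _ _ (gr (e j'))) smoothfun_sum.
  have := congr1 (fun w : 'rV_n => w 0 j') vA; rewrite !mxE => vAj.
  rewrite (_ : \sum_i _ = 0) ?mulr0//; rewrite -[RHS]vAj; apply: eq_bigr => i _.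
  by rewrite smoothfunM smoothfunZ smoothfun1 mulr1 !mxE.
have [d dE] := smooth_reciprocal dA.
(* Cramer's rule with global functions: [d] equals 1 / det A only near p, so Z represents alpha only
   there. *)
pose w : 'rV[C]_n := d *: ((\row_j alpha (e j)) *m \adj A).
exists (\sum_i w 0 i *: e i); set Z := \sum_i _.
have Ze j : g Z (e j) = d * \det A * alpha (e j).
  rewrite (scalar_sum _ _ (gr (e j))).
  have : (w *m A) 0 j = d * \det A * alpha (e j).
    by rewrite -scalemxAl -mulmxA mul_adj_mx mul_mx_scalar !mxE mulrA.
  by rewrite mxE => <-; apply: eq_bigr => i _; congr (_ * _); rewrite mxE.
near=> q.
(* Locality requires X to agree with its frame expansion on a whole neighbourhood of q, not just at
   q. *)
have frq : \forall r \near q, (forall i j, (e i (x j) : C) r = (i == j)%:R) /\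
    forall (X : V) (f : C), (X f : C) r =
      \sum_i (X (x i) : C) r * (e i f : C) r.
  near: q; exact: near_join.
have dq : d q * (\det A) q = 1 by near: q.
move=> X; pose D := X - \sum_i (X (x i) : C) *: e i.
have D0 : \forall r \near q, forall f : C, (D f : C) r = 0.
  near=> r => f; rewrite vfield_addE vfield_oppE smoothfunD smoothfunN vfield_sumE.
  have [_ ->] : (forall i j, (e i (x j) : C) r = (i == j)%:R) /\
    forall (X : V) (f : C), (X f : C) r =
      \sum_i (X (x i) : C) r * (e i f : C) r by near: r.
  by rewrite smoothfun_sum subrr.
have := scalar_local al D0; have := scalar_local (gl Z) D0.
rewrite /D !scalar_sub// !smoothfunD !smoothfunN => /subr0_eq -> /subr0_eq ->.
rewrite !scalar_sum// !smoothfun_sum; apply: eq_bigr => i _.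
by rewrite !smoothfunM Ze !smoothfunM dq mul1r.
Unshelve. all: by end_near. Qed.

(** A local solution is chosen at each point, and the global field evaluates at q the solution
    chosen for q. Definiteness of g makes it agree near p with the single field chosen at p, whence
    smoothness; the laws of a derivation hold pointwise. *)
Lemma riesz (alpha : V -> C) : scalar alpha ->
  exists Z, forall X, g Z X = alpha X.
Proof.
move=> al; have [[gl gr] gsym gpos] := gR.
pose Zl p := projT1 (cid (riesz_local p al)).
have ZlP p : \forall q \near p, forall X, g (Zl p) X q = alpha X q.
  by rewrite /Zl; case: cid.
have Zuniq Y q : (forall X, g Y X q = alpha X q) ->
    forall f : C, (Zl q f : C) q = (Y f : C) q.
  move=> Yq f; apply/eqP; rewrite -subr_eq0; apply/eqP.
  have : forall X, g (Zl q - Y) X q = 0.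
    move=> X; rewrite (scalar_sub _ _ (gr X)) smoothfunD smoothfunN Yq.
    by rewrite (nbhs_singleton (ZlP q)) subrr.
  by move=> /metric_nondegenerate/(_ f); rewrite vfield_addE vfield_oppE.
have Zs (f : C) : smooth (fun q => (Zl q f : C) q).
  apply: smooth_near => p; exists (Zl p f : C); first exact: smoothfunP.
  have := ZlP p; apply: filterS => q Zq; exact: Zuniq.
pose Zf (f : C) : C^o := mk_smooth (Zs f).
have Zd : Zf \in derivation (M := M).
  apply/asboolP; split=> [a f h|f h]; apply: smoothfun_eq => q.
    have [l _] := vfieldP (Zl q).
    by rewrite /Zf /= l.
  by rewrite /Zf /= vfieldM.
exists (VField Zd) => X; apply: smoothfun_eq => p.
rewrite -(nbhs_singleton (ZlP p)); apply/eqP; rewrite -subr_eq0.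
rewrite -smoothfunN -smoothfunD -(scalar_sub _ _ (gr X)); apply/eqP.
apply: (scalar_local (gr X)); have := ZlP p; apply: filterS => q Zq f.
by rewrite vfield_addE vfield_oppE smoothfunD smoothfunN /= (Zuniq _ _ Zq) subrr.
Qed.

Lemma metric_eq Y Z : (forall X, g Y X = g Z X) -> Y = Z.
Proof.
have [[gl gr] _ _] := gR.
move=> YZ; apply: vfield_eq => f q; apply/eqP; rewrite -subr_eq0; apply/eqP.
have /(_ _ f) : forall q (f : C), ((Y - Z) f : C) q = 0.
  move=> r; apply: metric_nondegenerate => X.
  by rewrite (scalar_sub _ _ (gr X)) YZ subrr.
by move=> /(_ q); rewrite vfield_addE vfield_oppE.
Qed.
End Riesz.

(** * Skew-torsion connections *)

Section VectorFieldAlgebra.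
Variables (R : realType) (n : nat) (M : manifold R n).
Local Notation C := (smoothfun M).
Local Notation V := (vfield M).
Implicit Types (X Y Z : V) (F : V -> V -> C) (a : C).

Lemma smooth_half_double (a : C) : (2^-1 : R) *: a + (2^-1 : R) *: a = a.
Proof. by rewrite -scalerDl (_ : 2^-1 + 2^-1 = 1 :> R) ?scale1r//; lra. Qed.

Lemma smooth_double_eq0 (a : C) : a + a = 0 -> a = 0.
Proof. by move=> a0; rewrite -(smooth_half_double a) -scalerDr a0 scaler0. Qed.

Lemma vfieldN X (f : C) : X (- f) = - (X f : C).
Proof. by rewrite -scaleN1r vfield_scale scaleN1r. Qed.

Lemma vfield_ext X Y : (forall f : C, (X f : C) = Y f) -> X = Y.
Proof. by move=> XY; apply/val_inj/funext. Qed.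

Lemma bracketE X Y (f : C) : bracket X Y f = (X (Y f) : C) - Y (X f).
Proof. by []. Qed.

Definition vfieldE := (bracketE, vfield_addE, vfield_oppE, vfield_scaleE,
  vfieldD, vfieldN, vfieldM).

Lemma vfield0 X : (X 0 : C) = 0.
Proof. by have := vfield_scale X 0 0; rewrite !scale0r. Qed.

Lemma bracketC X Y : bracket X Y = - bracket Y X.
Proof. by apply: vfield_ext => f; rewrite !vfieldE opprB. Qed.

Lemma bracketxx X : bracket X X = 0.
Proof. by apply: vfield_ext => f; rewrite bracketE subrr. Qed.

Lemma bracketDl X Y Z : bracket (X + Y) Z = bracket X Z + bracket Y Z.
Proof. by apply: vfield_ext => f; rewrite !vfieldE; ring. Qed.

Lemma bracketZl a X Y : bracket (a *: X) Y = a *: bracket X Y - (Y a : C) *: X.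
Proof. by apply: vfield_ext => f; rewrite !vfieldE; ring. Qed.

Lemma bracketDr X Y Z : bracket X (Y + Z) = bracket X Y + bracket X Z.
Proof. by rewrite bracketC bracketDl opprD -!bracketC. Qed.

Lemma bracketZr a X Y : bracket X (a *: Y) = a *: bracket X Y + (X a : C) *: Y.
Proof. by rewrite bracketC bracketZl opprB -scalerN -bracketC addrC. Qed.

Section Tensor2.
Variables (F : V -> V -> C) (Ft : tensor2 F).
Lemma tensor2Dl X Y Z : F (X + Y) Z = F X Z + F Y Z.
Proof. by have := Ft.2 Z 1 X Y; rewrite scale1r mul1r. Qed.
Lemma tensor2Dr X Y Z : F X (Y + Z) = F X Y + F X Z.
Proof. by have := Ft.1 X 1 Y Z; rewrite scale1r mul1r. Qed.
Lemma tensor20l X : F 0 X = 0.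
Proof. by apply: (addrI (F 0 X)); rewrite -tensor2Dl !addr0. Qed.
Lemma tensor20r X : F X 0 = 0.
Proof. by apply: (addrI (F X 0)); rewrite -tensor2Dr !addr0. Qed.
Lemma tensor2Zl a X Y : F (a *: X) Y = a * F X Y.
Proof. by have := Ft.2 Y a X 0; rewrite tensor20l !addr0. Qed.
Lemma tensor2Zr a X Y : F X (a *: Y) = a * F X Y.
Proof. by have := Ft.1 X a Y 0; rewrite tensor20r !addr0. Qed.
Lemma tensor2Nl X Y : F (- X) Y = - F X Y.
Proof. by rewrite -scaleN1r tensor2Zl mulN1r. Qed.
Lemma tensor2Nr X Y : F X (- Y) = - F X Y.
Proof. by rewrite -scaleN1r tensor2Zr mulN1r. Qed.
Definition tensor2E :=
  (tensor2Dl, tensor2Dr, tensor2Nl, tensor2Nr, tensor2Zl, tensor2Zr).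
End Tensor2.

Lemma tensor2_opp F : tensor2 F -> tensor2 (fun X Y => - F X Y).
Proof.
by move=> Ft; split=> [X a Y Z|Y a X Z] /=; rewrite !(tensor2E Ft); ring.
Qed.

Lemma form2_opp F : form2 F -> form2 (fun X Y => - F X Y).
Proof. by move=> [Ft F0]; split=> [|X]; [exact: tensor2_opp|rewrite F0 oppr0]. Qed.

Lemma dform2_opp F X Y Z : dform2 (fun A B => - F A B) X Y Z = - dform2 F X Y Z.
Proof. by rewrite /dform2 !vfieldN; ring. Qed.

Section Form2.
Variables (F : V -> V -> C) (Ff : form2 F).
Let Ft := Ff.1.

Lemma form2C X Y : F X Y = - F Y X.
Proof.
have := Ff.2 (X + Y); rewrite !(tensor2E Ft) !Ff.2 add0r addr0 => /eqP.
by rewrite addr_eq0 => /eqP.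
Qed.

Lemma dform2_rot X Y Z : dform2 F X Y Z = dform2 F Y Z X.
Proof. rewrite /dform2; ring. Qed.

Lemma dform2_alt X Y : dform2 F X X Y = 0.
Proof.
rewrite /dform2 Ff.2 (form2C X Y) vfieldN.
rewrite bracketxx (tensor20l Ft) (bracketC X Y) (tensor2Nl Ft) vfield0; ring.
Qed.

(** Tensoriality of d: the derivatives of the coefficient [a] along Y and Z cancel against those
    produced by the brackets. *)
Lemma dform2_linear Y Z : scalar (fun X => dform2 F X Y Z).
Proof.
move=> a X X'; rewrite /dform2.
rewrite !(bracketDl, bracketDr, bracketZl, bracketZr, tensor2E Ft).
rewrite !vfieldE.
rewrite (form2C X Z); ring.
Qed.

Lemma dform2Zl a X Y Z : dform2 F (a *: X) Y Z = a * dform2 F X Y Z.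
Proof.
have l := dform2_linear Y Z; have l0 : dform2 F 0 Y Z = 0.
  by have := l (-1) 0 0; rewrite scaler0 addr0 mulN1r addNr.
by have := l a X 0; rewrite !addr0 l0 addr0.
Qed.

Lemma dform2Zm a X Y Z : dform2 F X (a *: Y) Z = a * dform2 F X Y Z.
Proof. by rewrite dform2_rot dform2Zl -dform2_rot. Qed.

Lemma dform2Zr a X Y Z : dform2 F X Y (a *: Z) = a * dform2 F X Y Z.
Proof. by rewrite -dform2_rot dform2Zl dform2_rot. Qed.

Lemma dform2Nl X Y Z : dform2 F (- X) Y Z = - dform2 F X Y Z.
Proof. by rewrite -scaleN1r dform2Zl mulN1r. Qed.

Lemma dform2Nm X Y Z : dform2 F X (- Y) Z = - dform2 F X Y Z.
Proof. by rewrite dform2_rot dform2Nl -dform2_rot. Qed.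

Lemma dform2Nr X Y Z : dform2 F X Y (- Z) = - dform2 F X Y Z.
Proof. by rewrite -dform2_rot dform2Nl dform2_rot. Qed.
End Form2.
End VectorFieldAlgebra.

(** * Consequences of integrability for one complex structure *)

Section ComplexStructure.
Variables (R : realType) (n : nat) (M : manifold R n).
Local Notation C := (smoothfun M).
Local Notation V := (vfield M).
Variable I : {linear V -> V}.
Hypothesis II : forall X, I (I X) = - X.
Hypothesis NI : forall X Y, nijenhuis I X Y = 0.

Lemma bracket_II X Y :
  bracket (I X) (I Y) = bracket X Y + I (bracket (I X) Y) + I (bracket X (I Y)).
Proof.
have := NI X Y; rewrite /nijenhuis => /eqP; rewrite !subr_eq add0r => /eqP ->.
by rewrite addrAC.
Qed.

Section Holomorphic.
Variables F2 F3 : V -> V -> C.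
Hypotheses (f2 : form2 F2) (f3 : form2 F3).
Hypothesis F2I : forall X Y, F2 (I X) Y = - F3 X Y.
Hypothesis F3I : forall X Y, F3 (I X) Y = F2 X Y.

Let F2Ir X Y : F2 X (I Y) = - F3 X Y.
Proof. by rewrite (form2C f2) F2I opprK (form2C f3). Qed.
Let F3Ir X Y : F3 X (I Y) = F2 X Y.
Proof. by rewrite (form2C f3) F3I -(form2C f2). Qed.

(* d(F2 - i F3) vanishes on T^{1,0} x T^{1,0}, a bracket of (1,0) fields being
   of type (1,0). *)
Lemma dform2_20_eq0 X Y Z :
  dform2 F2 X Y Z - dform2 F2 (I X) (I Y) Z
    - dform2 F3 (I X) Y Z - dform2 F3 X (I Y) Z = 0.
Proof.
(* The left-hand side is the real part of d(F2 - i F3) on X - iIX, Y - iIY, Z. Integrability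
   replaces [IX, IY], after which every term cancels. *)
rewrite /dform2 bracket_II.
rewrite !(F2I, F2Ir, F3I, F3Ir, tensor2E f2.1, tensor2E f3.1, vfieldN).
ring.
Qed.

(* By hypothesis d(F2 - i F3) is then of type (1,2), on which I acts by -i. *)
Lemma dform2_I_of_03_eq0 X Y Z :
  dform2 F2 X Y Z - dform2 F2 (I X) (I Y) Z - dform2 F2 (I X) Y (I Z)
  - dform2 F2 X (I Y) (I Z) + dform2 F3 (I X) Y Z + dform2 F3 X (I Y) Z
  + dform2 F3 X Y (I Z) - dform2 F3 (I X) (I Y) (I Z) = 0 ->
  dform2 F3 (I X) (I Y) (I Z) = dform2 F2 X Y Z.
Proof.
have k12 A B D := dform2_20_eq0 A B D.
have k23 A B D : dform2 F2 A B D - dform2 F2 A (I B) (I D)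
    - dform2 F3 A (I B) D - dform2 F3 A B (I D) = 0.
  by have := dform2_20_eq0 B D A; rewrite -!(dform2_rot _ A).
have k13 A B D : dform2 F2 A B D - dform2 F2 (I A) B (I D)
    - dform2 F3 A B (I D) - dform2 F3 (I A) B D = 0.
  by have := dform2_20_eq0 D A B; rewrite !(dform2_rot _ D, dform2_rot _ (I D)).
move=> H.
have k1 := k12 X Y Z; have k2 := k23 X Y Z; have k3 := k13 X Y Z.
have l1 := k12 (I X) Y (I Z); have l2 := k23 (I X) (I Y) Z.
have l3 := k13 X (I Y) (I Z).
rewrite !(II, dform2Nl f2, dform2Nl f3, dform2Nm f2, dform2Nm f3,
  dform2Nr f2, dform2Nr f3) in l1 l2 l3.
(* The seven identities add up to 4 (dF2(X, Y, Z) - dF3(IX, IY, IZ)) = 0: the terms with two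
   arguments twisted in dF2, or one in dF3, cancel. The factor 4 is removed by two halvings. *)
apply/esym/subr0_eq; do 2! apply: smooth_double_eq0.
have S := congr2 +%R H (congr2 +%R k1 (congr2 +%R k2 (congr2 +%R k3
  (congr2 +%R l1 (congr2 +%R l2 l3))))).
rewrite /= !addr0 in S; rewrite -[RHS]S; ring.
Qed.
End Holomorphic.

Section Bismut.
Variables (g F : V -> V -> C) (c : V -> V -> V -> C).
Hypothesis gt : tensor2 g.
Hypothesis gI : forall X Y, g (I X) (I Y) = g X Y.
Hypothesis Fg : forall X Y, F X Y = g (I X) Y.
Hypothesis cF : forall X Y Z, c X Y Z = dform2 F (I X) (I Y) (I Z).

(* Koszul's formula for twice the Levi-Civita connection, corrected by the
   prescribed torsion form. *)
Definition koszul (X Y Z : V) : C :=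
  (X (g Y Z) : C) + Y (g Z X) - Z (g X Y)
  + g (bracket X Y) Z - g (bracket Y Z) X + g (bracket Z X) Y + c X Y Z.

(* Bismut's theorem: the connection with torsion dF(I., I., I.) preserves I. *)
Lemma koszul_I X Y Z : koszul X (I Y) Z + koszul X Y (I Z) = 0.
Proof.
have gIl A B : g (I A) B = - g A (I B) by rewrite -gI II (tensor2Nl gt).
have gIr A B : g A (I B) = - g (I A) B by rewrite gIl opprK.
have bN A B : bracket A (- B) = - bracket A B.
  by apply: vfield_ext => f; rewrite !vfieldE; ring.
have bNl A B : bracket (- A) B = - bracket A B.
  by apply: vfield_ext => f; rewrite !vfieldE; ring.
rewrite /koszul !cF !II /dform2 !Fg !(bN, bNl, bracket_II).
rewrite !(linearD I, linearN I, II, tensor2E gt, gIr, vfieldE).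
ring.
Qed.
End Bismut.
End ComplexStructure.

(** * The metric connection with prescribed skew torsion *)

Section SkewTorsionConnection.
Variables (R : realType) (n : nat) (M : manifold R n).
Local Notation C := (smoothfun M).
Local Notation V := (vfield M).

Lemma form3_twist (F : V -> V -> C) (I : {linear V -> V}) :
  form2 F -> form3 (fun X Y Z => dform2 F (I X) (I Y) (I Z)).
Proof.
move=> Ff; have l1 Y Z : scalar (fun X => dform2 F (I X) (I Y) (I Z)).
  by move=> a X X'; rewrite linearP (dform2_linear Ff).
have l2 X Z : scalar (fun Y => dform2 F (I X) (I Y) (I Z)).
  by move=> a Y Y'; rewrite !(dform2_rot _ (I X)) linearP (dform2_linear Ff).
have l3 X Y : scalar (fun Z => dform2 F (I X) (I Y) (I Z)).
  by move=> a Z Z'; rewrite -!(dform2_rot _ _ (I X)) linearP (dform2_linear Ff).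
split=> [X|Y Z|X Y] //; last exact: (dform2_alt Ff).
split; first by split=> [Y|Z]; [exact: l3|exact: l2].
by move=> Y; rewrite dform2_rot; exact: (dform2_alt Ff).
Qed.

Section Form3.
Variables (c : V -> V -> V -> C) (c3 : form3 c).
Lemma form3_swap12 X Y Z : c X Y Z = - c Y X Z.
Proof.
have [_ l a] := c3; have := a (X + Y) Z.
have Dl A B D E : c (A + B) D E = c A D E + c B D E.
  by have := l D E 1 A B; rewrite scale1r mul1r.
have [cf _ _] := c3; have Dm A B D E : c A (B + D) E = c A B E + c A D E.
  exact: (tensor2Dl (cf A).1).
by rewrite Dl !Dm !a add0r addr0 => /eqP; rewrite addr_eq0 => /eqP.
Qed.
Lemma form3_swap23 X Y Z : c X Y Z = - c X Z Y.
Proof. by have [cf _ _] := c3; exact: form2C. Qed.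
Lemma form3_rot X Y Z : c X Y Z = c Y Z X.
Proof. by rewrite form3_swap12 form3_swap23 opprK. Qed.
End Form3.

Variables (g : V -> V -> C) (c : V -> V -> V -> C).
Hypotheses (gR : riemannian_metric g) (c3 : form3 c).
Let gt : tensor2 g. Proof. by case: gR. Qed.
Let gC X Y : g X Y = g Y X. Proof. by case: gR. Qed.

Let cE X := tensor2E (let: And3 cf _ _ := c3 in (cf X).1).
Lemma koszul_linear3 X Y : scalar (koszul g c X Y).
Proof.
move=> a Z Z'; rewrite /koszul !(bracketDl, bracketDr, bracketZl, bracketZr).
rewrite !(tensor2E gt) !(cE X) !vfieldE (gC Z Y); ring.
Qed.

Lemma koszul_linear1 Y Z : scalar (fun X => koszul g c X Y Z).
Proof.
move=> a X X'; rewrite /koszul !(form3_rot c3 _ Y Z).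
rewrite !(bracketDl, bracketDr, bracketZl, bracketZr).
rewrite !(tensor2E gt) !(cE Y) !vfieldE (gC Z X); ring.
Qed.

Lemma koszul_leibniz X Y a Z : koszul g c X (a *: Y) Z =
  (X a : C) * g Y Z + (X a : C) * g Y Z + a * koszul g c X Y Z.
Proof.
rewrite /koszul !(bracketDl, bracketDr, bracketZl, bracketZr).
rewrite !(tensor2E gt) !(cE X) !vfieldE (gC Y X); ring.
Qed.

Lemma koszul_add2 X Y Y' Z :
  koszul g c X (Y + Y') Z = koszul g c X Y Z + koszul g c X Y' Z.
Proof.
rewrite /koszul !(bracketDl, bracketDr) !(tensor2E gt) !(cE X) !vfieldE; ring.
Qed.

Lemma koszul_metric (X Y Z : V) :
  koszul g c X Y Z + koszul g c X Z Y = (X (g Y Z) : C) + X (g Y Z).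
Proof.
rewrite /koszul (form3_swap23 c3 X Z) (bracketC Y X) (bracketC Z Y) (bracketC X Z).
rewrite !(tensor2E gt) (gC Z Y) (gC Z X) (gC Y X); ring.
Qed.

Lemma koszul_torsion X Y Z : koszul g c X Y Z - koszul g c Y X Z =
  (g (bracket X Y) Z + c X Y Z) + (g (bracket X Y) Z + c X Y Z).
Proof.
rewrite /koszul (form3_swap12 c3 Y X).
rewrite (bracketC Y X) (bracketC X Z) (bracketC Z Y) !(tensor2E gt).
rewrite (gC Z Y) (gC Z X) (gC Y X); ring.
Qed.

Let half : C := (2^-1 : R) *: (1 : C).
Let halfD (a : C) : half * (a + a) = a.
Proof. by rewrite mulrDr -mulrDl smooth_half_double mul1r. Qed.

Let koszul_half X Y : scalar (fun Z => half * koszul g c X Y Z).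
Proof. by move=> a Z Z'; rewrite koszul_linear3; ring. Qed.

(** Duality gives mere existence, hence the choice; all properties of the connection are then tested
    against g through [metric_eq]. *)
Definition skew_connection X Y : V := projT1 (cid (riesz gR (koszul_half X Y))).
Local Notation nabla := skew_connection.

Let nablaE X Y Z : g (nabla X Y) Z = half * koszul g c X Y Z.
Proof. by rewrite /skew_connection; case: cid. Qed.

Lemma skew_connection_linear : linear_connection nabla.
Proof.
split=> [Y a X X'|X Y Y'|X a Y]; apply: (metric_eq gR) => Z.
- by rewrite !(tensor2E gt) !nablaE koszul_linear1; ring.
- by rewrite !(tensor2E gt) !nablaE koszul_add2; ring.
- by rewrite !(tensor2E gt) !nablaE koszul_leibniz mulrDr halfD; ring.
Qed.

Lemma skew_connection_metric (X Y Z : V) :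
  (X (g Y Z) : C) = g (nabla X Y) Z + g Y (nabla X Z).
Proof. by rewrite (gC Y (nabla X Z)) !nablaE -mulrDr koszul_metric halfD. Qed.

Lemma skew_connection_torsion X Y Z : g X (torsion nabla Y Z) = c X Y Z.
Proof.
rewrite gC /torsion !(tensor2E gt) !nablaE -mulrBr koszul_torsion halfD.
by rewrite addrC addKr (form3_rot c3 X).
Qed.

(** As I is skew for g, commutation with the connection amounts to g(nabla_X (IY), Z) + g(nabla_X Y,
    IZ) = 0, which is half of [koszul_I]. *)
Lemma skew_connection_complex (I : {linear V -> V}) (F : V -> V -> C) X Y :
  (forall X, I (I X) = - X) -> (forall X Y, nijenhuis I X Y = 0) ->
  (forall X Y, g (I X) (I Y) = g X Y) -> (forall X Y, F X Y = g (I X) Y) ->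
  (forall X Y Z, c X Y Z = dform2 F (I X) (I Y) (I Z)) ->
  nabla X (I Y) = I (nabla X Y).
Proof.
move=> II NI gI Fg cF; apply: (metric_eq gR) => Z.
have -> : g (I (nabla X Y)) Z = - g (nabla X Y) (I Z).
  by rewrite -gI II (tensor2Nl gt).
rewrite !nablaE; apply/eqP; rewrite -subr_eq0 opprK -mulrDr.
by rewrite (koszul_I II NI gt gI Fg cF) mulr0.
Qed.

End SkewTorsionConnection.

(** * Bidegrees *)

Section TypeDecomposition.
Variables (R : realType) (n : nat) (M : manifold R n).
Local Notation C := (smoothfun M).
Local Notation V := (vfield M).
Variable I : {linear V -> V}.

Let half : C := (2^-1 : R) *: (1 : C).
Let half2 : half + half = 1. Proof. exact: smooth_half_double. Qed.
Let halfK (a : C) : half * a + half * a = a.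
Proof. by rewrite -mulrDl half2 mul1r. Qed.
(** The sign s in (X + s i I X) / 2, which lets one expansion cover both T^{1,0} and T^{0,1}. *)
Definition type_sign (b : bool) : C := if b then -1 else 1.

Lemma type_projE b X : type_proj I b X = (half *: X, (type_sign b * half) *: I X).
Proof. by rewrite /type_proj /type_sign; case: b; rewrite ?mulN1r ?scaleNr ?mul1r. Qed.

Section Bidegree2.
Variables P Q : V -> V -> C.
Hypotheses (Pt : tensor2 P) (Qt : tensor2 Q).

Lemma cext2_type_proj b1 b2 X Y :
  cext2 (fun A B => (P A B, Q A B)) (type_proj I b1 X) (type_proj I b2 Y) =
  (half * half * (P X Y - type_sign b2 * Q X (I Y) - type_sign b1 * Q (I X) Y
      - type_sign b1 * type_sign b2 * P (I X) (I Y)),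
   half * half * (Q X Y + type_sign b2 * P X (I Y) + type_sign b1 * P (I X) Y
      - type_sign b1 * type_sign b2 * Q (I X) (I Y))).
Proof.
rewrite !type_projE /cext2 /cext /cI /= !(tensor2E Pt) !(tensor2E Qt).
by congr (_, _) => /=; ring.
Qed.

Lemma type_part2_sum p (w : V -> V -> C * C) X Y : type_part2 I p w X Y =
  \sum_(b1 : bool) \sum_(b2 : bool) if (b1 + b2 == p)%N then
    cext2 w (type_proj I b1 X) (type_proj I b2 Y) else 0.
Proof.
by rewrite /type_part2 big_mkcond pair_big.
Qed.
End Bidegree2.

Lemma type_part3_sum p (w : V -> V -> V -> C * C) X Y Z :
  type_part3 I p w X Y Z =
  \sum_(b1 : bool) \sum_(b2 : bool) \sum_(b3 : bool)
    if (b1 + b2 + b3 == p)%N then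
    cext3 w (type_proj I b1 X) (type_proj I b2 Y) (type_proj I b3 Z) else 0.
Proof.
by rewrite /type_part3 big_mkcond pair_big pair_big.
Qed.

Lemma cext3_type_proj P Q b X Y Z : form2 P -> form2 Q ->
  cext3 (cdform2 (fun A B => (P A B, Q A B)))
    (type_proj I b X) (type_proj I b Y) (type_proj I b Z) =
  (half * half * half * (dform2 P X Y Z
      - type_sign b * type_sign b * (dform2 P (I X) (I Y) Z + dform2 P (I X) Y (I Z)
                       + dform2 P X (I Y) (I Z))
      - type_sign b * (dform2 Q (I X) Y Z + dform2 Q X (I Y) Z + dform2 Q X Y (I Z))
      + type_sign b * type_sign b * type_sign b * dform2 Q (I X) (I Y) (I Z)),
   half * half * half * (dform2 Q X Y Z
      - type_sign b * type_sign b * (dform2 Q (I X) (I Y) Z + dform2 Q (I X) Y (I Z)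
                       + dform2 Q X (I Y) (I Z))
      + type_sign b * (dform2 P (I X) Y Z + dform2 P X (I Y) Z + dform2 P X Y (I Z))
      - type_sign b * type_sign b * type_sign b * dform2 P (I X) (I Y) (I Z))).
Proof.
move=> Pf Qf; rewrite !type_projE /cext3 /cext2 /cext /cI /cdform2 /=.
rewrite !(dform2Zl Pf, dform2Zm Pf, dform2Zr Pf, dform2Zl Qf,
  dform2Zm Qf, dform2Zr Qf).
by congr (_, _) => /=; ring.
Qed.

Hypothesis II : forall X, I (I X) = - X.
Variables F2 F3 : V -> V -> C.
Hypotheses (f2 : form2 F2) (f3 : form2 F3).
Let t2 := f2.1.
Let t3 := f3.1.
Let w A B := (F2 A B, - F3 A B).
Let wbar A B := (F2 A B, F3 A B).
Let quarterK (a : C) : half * half * (a + a + (a + a)) = a.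
Proof. by rewrite -mulrA !mulrDr !halfK. Qed.

Let cext2_w b1 b2 X Y : cext2 w (type_proj I b1 X) (type_proj I b2 Y) =
  (half * half * (F2 X Y - type_sign b2 * - F3 X (I Y) - type_sign b1 * - F3 (I X) Y
      - type_sign b1 * type_sign b2 * F2 (I X) (I Y)),
   half * half * (- F3 X Y + type_sign b2 * F2 X (I Y) + type_sign b1 * F2 (I X) Y
      - type_sign b1 * type_sign b2 * - F3 (I X) (I Y))).
Proof. exact: (cext2_type_proj t2 (tensor2_opp t3)). Qed.
Let cext2_wbar b1 b2 X Y : cext2 wbar (type_proj I b1 X) (type_proj I b2 Y) = _ :=
  cext2_type_proj t2 t3 b1 b2 X Y.

Hypothesis htype : has_type2 I 0 w.

(** Real part of omega(IX, Y) = -i omega(X, Y), which holds because I acts by -i on T^{0,1}. *)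
Lemma has_type02_re X Y : F2 (I X) Y = - F3 X Y.
Proof.
have wE A B : cext2 w (type_proj I false A) (type_proj I false B) = w A B.
  by rewrite -[RHS]htype type_part2_sum !big_bool /= !add0r.
have re : _ = F2 (I X) Y := congr1 fst (wE (I X) Y).
have im : _ = - F3 X Y := congr1 snd (wE X Y).
rewrite cext2_w /type_sign /= in re; rewrite cext2_w /type_sign /= in im.
by rewrite -[LHS]re -[RHS]im II !(tensor2E t2) !(tensor2E t3); ring.
Qed.

Lemma has_type02_im X Y : F3 (I X) Y = F2 X Y.
Proof. by rewrite -[LHS]opprK -has_type02_re II (tensor2Nl t2) opprK. Qed.

Let F2r X Y : F2 X (I Y) = - F3 X Y.
Proof. by rewrite (form2C f2) has_type02_re opprK (form2C f3). Qed.
Let F3r X Y : F3 X (I Y) = F2 X Y.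
Proof. by rewrite (form2C f3) has_type02_im -(form2C f2). Qed.
Let relE := (has_type02_re, has_type02_im, F2r, F3r).

(** Purity of [w], of type (0,2), and of its conjugate [wbar], of type (2,0): a single summand
    survives in the sums over bidegrees defining [delbar] and [del]. *)
Let w1 : type_part2 I 1 w = fun _ _ => 0.
Proof.
apply/funext => X; apply/funext => Y.
rewrite type_part2_sum !big_bool /= !cext2_w /type_sign !relE.
by rewrite !(addr0, add0r); congr (_, _) => /=; ring.
Qed.
Let w2 : type_part2 I 2 w = fun _ _ => 0.
Proof.
apply/funext => X; apply/funext => Y.
rewrite type_part2_sum !big_bool /= !cext2_w /type_sign !relE.
by rewrite !(addr0, add0r); congr (_, _) => /=; ring.
Qed.
Let wbar0 : type_part2 I 0 wbar = fun _ _ => 0.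
Proof.
apply/funext => X; apply/funext => Y.
rewrite type_part2_sum !big_bool /= !cext2_wbar /type_sign !relE.
by rewrite !(addr0, add0r); congr (_, _) => /=; ring.
Qed.
Let wbar1 : type_part2 I 1 wbar = fun _ _ => 0.
Proof.
apply/funext => X; apply/funext => Y.
rewrite type_part2_sum !big_bool /= !cext2_wbar /type_sign !relE.
by rewrite !(addr0, add0r); congr (_, _) => /=; ring.
Qed.
Let wbar2 : type_part2 I 2 wbar = wbar.
Proof.
apply/funext => X; apply/funext => Y.
rewrite type_part2_sum !big_bool /= !cext2_wbar /type_sign !relE.
rewrite !(addr0, add0r) /wbar.
rewrite -[in RHS](quarterK (F2 X Y)) -[in RHS](quarterK (F3 X Y)).
by congr (_, _) => /=; ring.
Qed.

Lemma type_part3_zero p X Y Z :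
  type_part3 I p (cdform2 (fun _ _ : V => (0 : C * C))) X Y Z = 0.
Proof.
have d0 A B D : cdform2 (fun _ _ : V => (0 : C * C)) A B D = 0.
  by rewrite /cdform2 /dform2 /= !vfield0 !(addr0, subr0).
rewrite /type_part3 big1// => b _; rewrite /cext3 /cext2 /cext /cI !d0 /=.
by rewrite !(oppr0, addr0).
Qed.

(* Real and imaginary parts, up to the factor 1/8, of the (0,3)-component of
   d(F2 - i F3), that is of its value on X + iIX, Y + iIY, Z + iIZ. *)
Definition re03 X Y Z : C :=
  dform2 F2 X Y Z - dform2 F2 (I X) (I Y) Z - dform2 F2 (I X) Y (I Z)
  - dform2 F2 X (I Y) (I Z) + dform2 F3 (I X) Y Z + dform2 F3 X (I Y) Z
  + dform2 F3 X Y (I Z) - dform2 F3 (I X) (I Y) (I Z).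

Definition im03 X Y Z : C :=
  - dform2 F3 X Y Z + dform2 F3 (I X) (I Y) Z + dform2 F3 (I X) Y (I Z)
  + dform2 F3 X (I Y) (I Z) + dform2 F2 (I X) Y Z + dform2 F2 X (I Y) Z
  + dform2 F2 X Y (I Z) - dform2 F2 (I X) (I Y) (I Z).

Lemma delbarE X Y Z : delbar I w X Y Z =
  (half * half * half * re03 X Y Z, half * half * half * im03 X Y Z).
Proof.
have w0 : type_part2 I 0 w = w.
  by apply/funext => A; apply/funext => B; exact: htype.
rewrite /delbar !big_ord_recl big_ord0 /= w0 w1 w2 !type_part3_zero !addr0.
rewrite type_part3_sum !big_bool /= !add0r /w.
rewrite (cext3_type_proj _ _ _ _ f2 (form2_opp f3)).
by rewrite !dform2_opp /type_sign /re03 /im03; congr (_, _) => /=; ring.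
Qed.

(** Conjugation exchanges the two forms and the bidegrees (0,3) and (3,0), so only the sign of the
    imaginary part differs from [delbarE]. *)
Lemma delE X Y Z : del I wbar X Y Z =
  (half * half * half * re03 X Y Z, - (half * half * half * im03 X Y Z)).
Proof.
rewrite /del !big_ord_recl big_ord0 /= wbar0 wbar1 wbar2.
rewrite !type_part3_zero !add0r !addr0.
rewrite type_part3_sum !big_bool /= !addr0 /wbar (cext3_type_proj _ _ _ _ f2 f3).
by rewrite /type_sign /re03 /im03; congr (_, _) => /=; ring.
Qed.

Lemma delbar_eq0_iff : (forall X Y Z, delbar I w X Y Z = 0) <->
  (forall X Y Z, del I wbar X Y Z = 0).
Proof.
split=> H X Y Z; have := H X Y Z; rewrite delbarE delE => /pair_equal_spec[-> E].
  by rewrite E oppr0.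
by rewrite -[X in (_, X)]opprK E oppr0.
Qed.

Lemma delbar_eq0_re X Y Z : delbar I w X Y Z = 0 -> re03 X Y Z = 0.
Proof.
have half0 a : half * a = 0 -> a = 0.
  by rewrite -{2}(halfK a) => ->; rewrite addr0.
by rewrite delbarE => /(congr1 fst) /=; rewrite -!mulrA => /half0/half0/half0.
Qed.

End TypeDecomposition.

(** * Construction of the HKT-connection *)

Theorem theorem1 (R : realType) (n : nat) (M : manifold R n)
    (I1 I2 I3 : {linear vfield M -> vfield M})
    (hI : hypercomplex I1 I2 I3)
    (F2 F3 : vfield M -> vfield M -> smoothfun M)
    (hF2 : form2 F2) (hF3 : form2 F3)
    (htype : has_type2 I1 0 (fun X Y => (F2 X Y, - F3 X Y))) :
  ((forall X Y Z, delbar I1 (fun X Y => (F2 X Y, - F3 X Y)) X Y Z = 0) <->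
   (forall X Y Z, del I1 (fun X Y => (F2 X Y, F3 X Y)) X Y Z = 0)) /\
  ((forall X Y Z, delbar I1 (fun X Y => (F2 X Y, - F3 X Y)) X Y Z = 0) ->
   riemannian_metric (fun X Y => - F2 (I2 X) Y) ->
   hkt_structure I1 I2 I3 (fun X Y => - F2 (I2 X) Y)).
Proof.
have [[II1 NI1] [II2 NI2] [II3 NI3] I12 I21] := hI.
split; first exact: (delbar_eq0_iff II1 hF2 hF3 htype).
move=> dbar; set g := fun X Y => - F2 (I2 X) Y => gR.
have t2 := hF2.1; have t3 := hF3.1.
have [gt gC _] := gR.
have F2I := has_type02_re II1 hF2 hF3 htype.
have F3I := has_type02_im II1 hF2 hF3 htype.
have F2g X Y : F2 X Y = g (I2 X) Y by rewrite /g II2 (tensor2Nl t2) opprK.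
have I23 X : I2 (I3 X) = I1 X.
  by rewrite -I12 I21 -I12 II2 linearN opprK.
have F3g X Y : F3 X Y = g (I3 X) Y by rewrite /g I23 F2I opprK.
(* Invariance is symmetry of g played against skewness of F2: g(I2 X, I2 Y) = F2(X, I2 Y) = -F2(I2
   Y, X) = g(Y, X). The same argument with F3 gives I3. *)
have g2 X Y : g (I2 X) (I2 Y) = g X Y.
  by rewrite -F2g (form2C hF2) [RHS]gC.
have g3 X Y : g (I3 X) (I3 Y) = g X Y.
  by rewrite -F3g (form2C hF3) F3g II3 (tensor2Nl gt) opprK [RHS]gC.
have g1 X Y : g (I1 X) (I1 Y) = g X Y by rewrite -!I23 g2 g3.
split; first by split=> // X Y; rewrite g1 g2 g3.
pose c X Y Z := dform2 F2 (I2 X) (I2 Y) (I2 Z).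
have c3 : form3 c by exact: form3_twist.
have cE X Y Z : c X Y Z = dform2 F3 (I3 X) (I3 Y) (I3 Z).
  (* Writing I3 = I1 I2 turns the right-hand side into dF3(I1 ., I1 ., I1 .) at the vectors I2 X, I2
     Y, I2 Z. *)
  rewrite -!I12 (dform2_I_of_03_eq0 II1 NI1 hF2 hF3 F2I F3I)//.
  exact: (delbar_eq0_re II1 hF2 hF3 htype (dbar _ _ _)).
pose nabla := skew_connection gR c3.
have n2 X Y : nabla X (I2 Y) = I2 (nabla X Y).
  exact: (skew_connection_complex gR c3 (F := F2)).
have n3 X Y : nabla X (I3 Y) = I3 (nabla X Y).
  exact: (skew_connection_complex gR c3 (F := F3)).
exists nabla; split.
- exact: skew_connection_linear.
- exact: (skew_connection_metric gR c3).
- by move=> X Y; split=> //; rewrite -!I23 n2 n3.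
- have -> : (fun X Y Z => g X (torsion nabla Y Z)) = c; last exact: c3.
  apply/funext => X; apply/funext => Y; apply/funext => Z.
  exact: (skew_connection_torsion gR c3).
Qed.
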